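(* Let $C, A^1,\dots,A^m$ be real symmetric $n\times n$ matrices and $b\in\mathbb{R}^m$, and consider the primal-dual pair $$(\mathbf{P})\quad \min_X\ C\bullet X \ \text{ s.t. } A^i\bullet X=b_i\ (i=1,\dots,m),\ X\succeq 0,$$ $$(\mathbf{D})\quad \max_{y}\ b^Ty \ \text{ s.t. } C-\sum_{i=1}^m A^iy_i\succeq 0 .$$ Suppose $\mathbf{P}$ and $\mathbf{D}$ are feasible. Let $v_a:[0,\pi/2]\to\mathbb{R}$ be the limiting pd-regularized optimal value function $v_a(\theta)=\lim_{t\downarrow 0} v(t\cos\theta,t\sin\theta)$ (defined in the context). Then: 1. If the singularity degree of $\mathbf{D}$ is one, then $v_a$ is continuous at $\theta=\pi/2$. 2. If the singularity degree of $\mathbf{P}$ is one, then $v_a$ is continuous at $\theta=0$. 3. If the singularity degree of both $\mathbf{P}$ and $\mathbf{D}$ is one, then $v_a$ is continuous at $\theta=0$ and $\theta=\pi/2$; furthermore, if in addition the duality gap is nonzero, i.e. $v(\mathbf{P})\neq v(\mathbf{D})$, then $v_a$ is a monotonically decreasing continuous bijective function from $[0,\pi/2]$ onto $[v(\mathbf{D}),v(\mathbf{P})]$.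
   Context: $v(\mathbf{P})$ and $v(\mathbf{D})$ denote the optimal values of $\mathbf{P}$ and $\mathbf{D}$ (finite when both are feasible). $I$ is the identity matrix. For $\varepsilon,\eta\ge 0$ define the regularized problems $$\mathbf{P}(\varepsilon,\eta):\ \min_X (C+\varepsilon I)\bullet X \text{ s.t. } A^i\bullet X=b_i+\eta A^i\bullet I\ (i=1,\dots,m),\ X\succeq 0,$$ $$\mathbf{D}(\varepsilon,\eta):\ \max_{y}\ \sum_{i=1}^m (b_i+\eta A^i\bullet I)y_i \text{ s.t. } C-\sum_{i=1}^m A^iy_i+\varepsilon I\succeq 0.$$ For $(\varepsilon,\eta)\neq(0,0)$ with $\varepsilon,\eta\ge 0$, $v(\varepsilon,\eta)$ denotes the common optimal value of $\mathbf{P}(\varepsilon,\eta)$ and $\mathbf{D}(\varepsilon,\eta)$ (the pd-regularized optimal value function). The limit defining $v_a(\theta)$ exists for every $\theta\in[0,\pi/2]$ when $\mathbf{P},\mathbf{D}$ are feasible. Singularity degree one: $\mathbf{D}$ has singularity degree one if it is feasible and there exists a nonzero $X\succeq 0$ with $C\bullet X=0$ and $A^i\bullet X=0$ for all $i$, such that some $y\in\mathbb{R}^m$ has $C-\sum_i A^iy_i$ in the relative interior of the face $\{Z\succeq 0: Z\bullet X=0\}$ of the positive semidefinite cone. $\mathbf{P}$ has singularity degree one if it is feasible and there exists a nonzero $S\succeq 0$ of the form $S=\sum_i y_iA^i$ with $b^Ty=0$ (so $S\bullet X=0$ for every $X$ in the affine set $\{X: A^i\bullet X=b_i\ \forall i\}$),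 such that some $X$ with $A^i\bullet X=b_i$ for all $i$ lies in the relative interior of the face $\{Z\succeq 0: Z\bullet S=0\}$. *)

(* Defs.v *)
From HB Require Import structures.
From mathcomp Require Import all_boot all_order all_algebra.
From mathcomp Require Import all_classical all_reals all_analysis.
Set Implicit Arguments. Unset Strict Implicit. Unset Printing Implicit Defensive.
Import Order.TTheory GRing.Theory Num.Theory.
Import numFieldNormedType.Exports.
Local Open Scope classical_set_scope.
Local Open Scope ring_scope.

Section SDP.
Variables (R : realType) (n m : nat).
Implicit Types (X Y Z : 'M[R]_n).

Definition mdot (A B : 'M[R]_n) : R := \tr (A^T *m B).

Definition symm_mx (A : 'M[R]_n) : Prop := A^T = A.

Definition psd (A : 'M[R]_n) : Prop :=
  symm_mx A /\ forall x : 'cV[R]_n, 0 <= (x^T *m A *m x) 0 0.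

Definition aff_hull (S : set 'M[R]_n) : set 'M[R]_n :=
  [set Z | exists (k : nat) (lam : 'I_k -> R) (P : 'I_k -> 'M[R]_n),
      (forall i, S (P i)) /\ \sum_(i < k) lam i = 1 /\
      Z = \sum_(i < k) lam i *: P i].

Definition rel_interior (S : set 'M[R]_n) : set 'M[R]_n :=
  [set Z | S Z /\ exists e : R, 0 < e /\
     forall W, aff_hull S W -> mdot (W - Z) (W - Z) < e ^+ 2 -> S W].

Definition psd_face X : set 'M[R]_n := [set Z | psd Z /\ mdot Z X = 0].

Variables (C : 'M[R]_n) (A : 'I_m -> 'M[R]_n) (b : 'I_m -> R).

Definition dual_slack (y : 'I_m -> R) : 'M[R]_n :=
  C - \sum_(i < m) y i *: A i.

Definition primal_feasible : Prop :=
  exists X, psd X /\ forall i, mdot (A i) X = b i.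

Definition dual_feasible : Prop := exists y, psd (dual_slack y).

Definition vP : R :=
  inf [set mdot C X | X in [set X | psd X /\ forall i, mdot (A i) X = b i]].

Definition vD : R :=
  sup [set \sum_(i < m) b i * y i | y in [set y | psd (dual_slack y)]].

(* pd-regularized optimal value v(eps, eta): optimal value of P(eps,eta)
   (which equals that of D(eps,eta) for (eps,eta) <> (0,0)) *)
Definition vreg (eps eta : R) : R :=
  inf [set mdot (C + eps%:M) X | X in
        [set X | psd X /\
           forall i, mdot (A i) X = b i + eta * mdot (A i) 1%:M]].

Definition va (theta : R) : R :=
  lim (vreg (t * cos theta) (t * sin theta) @[t --> (0:R)^'+] : set_system R^o).

Definition D_sing_deg_one : Prop :=
  dual_feasible /\
  exists X, X <> 0 /\ psd X /\ mdot C X = 0 /\ (forall i, mdot (A i) X = 0) /\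
    exists y, rel_interior (psd_face X) (dual_slack y).

Definition P_sing_deg_one : Prop :=
  primal_feasible /\
  exists y : 'I_m -> R,
    let S := \sum_(i < m) y i *: A i in
    S <> 0 /\ psd S /\ \sum_(i < m) b i * y i = 0 /\
    exists X, (forall i, mdot (A i) X = b i) /\ rel_interior (psd_face S) X.

End SDP.

(* Main.v *)
Require Import Defs.
From HB Require Import structures.
From mathcomp Require Import all_boot all_order all_algebra.
From mathcomp Require Import all_classical all_reals all_analysis.
From mathcomp Require Import ring lra zify.
From mathcomp Require ordered_qelim qe_rcf polyrcf.
Set Implicit Arguments.
Unset Strict Implicit.
Unset Printing Implicit Defensive.
Import Order.TTheory GRing.Theory Num.Theory.
Import numFieldNormedType.Exports.
Local Open Scope classical_set_scope.
Local Open Scope ring_scope.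

(* For fixed [theta] the value [vreg (t cos theta) (t sin theta)] is definable
   over the reals, so by quantifier elimination its comparison with any constant
   is eventually decided as [t] decreases to [0]: the limit defining [va] exists.

   Replacing [(C, A, b)] by [(B, G, c)], where [B] is primal feasible, [G] spans
   the symmetric matrices orthogonal to all [A i] and [c j = G j . C], exchanges
   the primal and the dual problem, and strong duality gives
   [va theta + va' (pi / 2 - theta) = C . B].  So every statement at
   [theta = 0] is the dual of a statement at [theta = pi / 2].

   If [D] has singularity degree one with certificate [Y], a nearly optimal
   solution of [P(0, eta / 2)] is bounded on the kernel of [Y]; keeping that
   block and completing it by bounded entries, a multiple of [Y] of order
   [1 / eta] restores positivity.  This yields a nearly optimal solution of
   [P(0, eta)] with trace [O(1 / eta)], whence
   [va theta <= va (pi / 2) + K cot theta].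

   The value is nondecreasing and concave in [eps] for fixed [eta]; hence [va] is
   a concave nondecreasing function of [cot theta], and dually a convex
   nonincreasing function of [tan theta].  If [va] took the same value twice, it
   would be constant to the left by concavity and to the right by convexity, so
   continuity at both ends would force [vP = vD]. *)

(** * Trace inner product, bilinear forms and positive semidefinite matrices *)

Section MatrixDot.
Context {R : realType} {n : nat}.
Implicit Types (X Y Z : 'M[R]_n) (x y z : 'cV[R]_n).

Lemma mdotE X Y : mdot X Y = \sum_i \sum_j X i j * Y i j.
Proof.
rewrite /mdot /mxtrace exchange_big /=; apply: eq_bigr => j _.
by rewrite mxE; apply: eq_bigr => i _; rewrite mxE.
Qed.

Lemma mdotC X Y : mdot X Y = mdot Y X.
Proof. by rewrite /mdot -mxtrace_tr trmx_mul trmxK. Qed.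

Lemma mdotDr X Y Z : mdot X (Y + Z) = mdot X Y + mdot X Z.
Proof. by rewrite /mdot mulmxDr mxtraceD. Qed.

Lemma mdotZr X a Y : mdot X (a *: Y) = a * mdot X Y.
Proof. by rewrite /mdot -scalemxAr mxtraceZ. Qed.

Lemma mdot0r X : mdot X 0 = 0.
Proof. by rewrite /mdot mulmx0 mxtrace0. Qed.

Lemma mdotNr X Y : mdot X (- Y) = - mdot X Y.
Proof. by rewrite -scaleN1r mdotZr mulN1r. Qed.

Lemma mdotBr X Y Z : mdot X (Y - Z) = mdot X Y - mdot X Z.
Proof. by rewrite mdotDr mdotNr. Qed.

Lemma mdot_sumr X (I : Type) (r : seq I) (P : pred I) (F : I -> 'M[R]_n) :
  mdot X (\sum_(i <- r | P i) F i) = \sum_(i <- r | P i) mdot X (F i).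
Proof. by apply: big_morph => [Y Z|]; rewrite ?mdotDr ?mdot0r. Qed.

Lemma mdotDl X Y Z : mdot (Y + Z) X = mdot Y X + mdot Z X.
Proof. by rewrite !(mdotC _ X) mdotDr. Qed.

Lemma mdotZl X a Y : mdot (a *: Y) X = a * mdot Y X.
Proof. by rewrite !(mdotC _ X) mdotZr. Qed.

Lemma mdot0l X : mdot 0 X = 0.
Proof. by rewrite mdotC mdot0r. Qed.

Lemma mdotNl X Y : mdot (- Y) X = - mdot Y X.
Proof. by rewrite !(mdotC _ X) mdotNr. Qed.

Lemma mdotBl X Y Z : mdot (Y - Z) X = mdot Y X - mdot Z X.
Proof. by rewrite !(mdotC _ X) mdotBr. Qed.

Lemma mdot_suml X (I : Type) (r : seq I) (P : pred I) (F : I -> 'M[R]_n) :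
  mdot (\sum_(i <- r | P i) F i) X = \sum_(i <- r | P i) mdot (F i) X.
Proof. by rewrite mdotC mdot_sumr; apply: eq_bigr => i _; rewrite mdotC. Qed.

Lemma mdot_tr X Y : mdot X^T Y^T = mdot X Y.
Proof. by rewrite /mdot -mxtrace_tr !trmx_mul !trmxK mxtrace_mulC. Qed.

Lemma mdot1r X : mdot X 1%:M = \tr X.
Proof. by rewrite /mdot mulmx1 mxtrace_tr. Qed.

Lemma mdot_ge0 X : 0 <= mdot X X.
Proof.
rewrite mdotE; do 2!apply: sumr_ge0 => ? _.
by rewrite -expr2 sqr_ge0.
Qed.

Definition bform X x y : R := (x^T *m X *m y) 0 0.

Lemma bformE X x y : bform X x y = \sum_i \sum_j x i 0 * X i j * y j 0.
Proof.
rewrite /bform mxE exchange_big /=; apply: eq_bigr => j _.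
by rewrite mxE mulr_suml; apply: eq_bigr => i _; rewrite mxE.
Qed.

Lemma bform_tr X x y : bform X x y = bform X^T y x.
Proof.
have tE : y^T *m X^T *m x = (x^T *m X *m y)^T by rewrite !trmx_mul trmxK mulmxA.
by rewrite /bform tE [RHS]mxE.
Qed.

Lemma bformC X x y : symm_mx X -> bform X x y = bform X y x.
Proof. by move=> sX; rewrite bform_tr sX. Qed.

Lemma mdot_outer X x y : mdot X (x *m y^T) = bform X x y.
Proof.
by rewrite /mdot mulmxA mxtrace_mulC mulmxA [LHS]big_ord1 -/(bform _ _ _) -bform_tr.
Qed.

Lemma bformDl X x y z : bform X (x + y) z = bform X x z + bform X y z.
Proof. by rewrite /bform linearD /= !mulmxDl mxE. Qed.

Lemma bformDr X x y z : bform X x (y + z) = bform X x y + bform X x z.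
Proof. by rewrite bform_tr bformDl -!bform_tr. Qed.

Lemma bformZl X a x y : bform X (a *: x) y = a * bform X x y.
Proof. by rewrite /bform linearZ /= -!scalemxAl mxE. Qed.

Lemma bformZr X a x y : bform X x (a *: y) = a * bform X x y.
Proof. by rewrite bform_tr bformZl -bform_tr. Qed.

Lemma bformDm X Y x y : bform (X + Y) x y = bform X x y + bform Y x y.
Proof. by rewrite -!mdot_outer mdotDl. Qed.

Lemma bformNm X x y : bform (- X) x y = - bform X x y.
Proof. by rewrite -!mdot_outer mdotNl. Qed.

Lemma bformBm X Y x y : bform (X - Y) x y = bform X x y - bform Y x y.
Proof. by rewrite -!mdot_outer mdotBl. Qed.

Lemma bformZm a X x y : bform (a *: X) x y = a * bform X x y.
Proof. by rewrite -!mdot_outer mdotZl. Qed.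

Lemma bform_mul X Y Z x y : bform (Y^T *m X *m Z) x y = bform X (Y *m x) (Z *m y).
Proof. by rewrite /bform trmx_mul !mulmxA. Qed.

Lemma bform1E x : bform 1%:M x x = \sum_i x i 0 ^+ 2.
Proof.
by rewrite /bform mulmx1 mxE; apply: eq_bigr => i _; rewrite mxE.
Qed.

Lemma bform1_ge0 x : 0 <= bform 1%:M x x.
Proof. by rewrite bform1E; apply: sumr_ge0 => i _; rewrite sqr_ge0. Qed.

Lemma bform1_eq0 x : bform 1%:M x x = 0 -> x = 0.
Proof.
rewrite bform1E => /eqP; rewrite psumr_eq0 => [/allP x0|i _]; last exact: sqr_ge0.
apply/colP => i; rewrite mxE; apply/eqP; rewrite -sqrf_eq0.
by apply: x0; rewrite mem_index_enum.
Qed.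

Lemma bform_delta X i j : bform X (delta_mx i 0) (delta_mx j 0) = X i j.
Proof. by rewrite /bform trmx_delta -rowE -colE !mxE. Qed.

Lemma bform_outer x y z : bform (x *m x^T) y z = bform 1%:M x y * bform 1%:M x z.
Proof.
rewrite [bform _ x y]bformC; last by rewrite /symm_mx trmx1.
by rewrite /bform !mulmx1 mulmxA -mulmxA mxE big_ord1.
Qed.

Lemma symm_mxD X Y : symm_mx X -> symm_mx Y -> symm_mx (X + Y).
Proof. by rewrite /symm_mx linearD /= => -> ->. Qed.

Lemma symm_mxN X : symm_mx X -> symm_mx (- X).
Proof. by rewrite /symm_mx linearN /= => ->. Qed.

Lemma symm_mxZ a X : symm_mx X -> symm_mx (a *: X).
Proof. by rewrite /symm_mx linearZ /= => ->. Qed.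

Lemma symm_mx_sum (I : Type) (r : seq I) (F : I -> 'M[R]_n) :
  (forall i, symm_mx (F i)) -> symm_mx (\sum_(i <- r) F i).
Proof. by move=> sF; rewrite /symm_mx linear_sum /=; apply: eq_bigr => i _; exact: sF. Qed.

(** Makes a solution of linear equations with symmetric coefficients symmetric without changing its
    pairings. *)
Definition sympart X : 'M[R]_n := 2^-1 *: (X + X^T).

Lemma symm_sympart X : symm_mx (sympart X).
Proof. by apply: symm_mxZ; rewrite /symm_mx linearD /= trmxK addrC. Qed.

Lemma mdot_sympart X Y : symm_mx Y -> mdot (sympart X) Y = mdot X Y.
Proof. by move=> sY; rewrite mdotZl mdotDl -{2}sY mdot_tr; lra. Qed.

Lemma sympart_id X : symm_mx X -> sympart X = X.
Proof. by move=> sX; apply/matrixP => i j; rewrite /sympart sX !mxE; lra. Qed.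

Lemma symm_scalar_mx (a : R) : symm_mx (a%:M : 'M[R]_n).
Proof. exact: tr_scalar_mx. Qed.

Lemma psdD X Y : psd X -> psd Y -> psd (X + Y).
Proof.
move=> [sX pX] [sY pY]; split=> [|x]; first exact: symm_mxD.
by rewrite -/(bform _ x x) bformDm addr_ge0 ?pX ?pY.
Qed.

Lemma psdZ a X : 0 <= a -> psd X -> psd (a *: X).
Proof.
move=> a0 [sX pX]; split=> [|x]; first exact: symm_mxZ.
by rewrite -/(bform _ x x) bformZm mulr_ge0 ?pX.
Qed.

Lemma psd_outer x : psd (x *m x^T).
Proof.
split=> [|y]; first by rewrite /symm_mx trmx_mul trmxK.
by rewrite -/(bform _ y y) bform_outer -expr2 sqr_ge0.
Qed.

Lemma psd_scalar a : 0 <= a -> psd (a%:M : 'M[R]_n).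
Proof.
move=> a0; rewrite -scalemx1; apply: psdZ => //.
split; [exact: symm_scalar_mx|exact: bform1_ge0].
Qed.

Lemma psd0 : psd (0 : 'M[R]_n).
Proof. by rewrite -(scale0r 1%:M); apply/psdZ/psd_scalar. Qed.

(** Evaluation at the vertex [- b / c] gives the discriminant bound; [c = 0] forces [b = 0]. *)
Lemma quad_discr (a b c : R) : 0 <= c ->
  (forall t, 0 <= a + 2 * t * b + t ^+ 2 * c) -> b ^+ 2 <= a * c.
Proof.
rewrite le_eqVlt => /predU1P[<- h|c0 h].
  have [->|b0] := eqVneq b 0; first by rewrite expr0n mulr0.
  (* With [c = 0] the expression is affine in [t], and this point gives it the value [-1]. *)
  have := h (- (a + 1) / (2 * b)); rewrite mulr0 addr0.
  suff -> : 2 * (- (a + 1) / (2 * b)) * b = - (a + 1) by lra.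
  by field.
have := h (- b / c).
suff -> : a + 2 * (- b / c) * b + (- b / c) ^+ 2 * c = (a * c - b ^+ 2) / c.
  by rewrite pmulr_lge0 ?invr_gt0 // subr_ge0.
by field; rewrite gt_eqF.
Qed.

Lemma bform_CauchySchwarz X x y : psd X ->
  bform X x y ^+ 2 <= bform X x x * bform X y y.
Proof.
move=> [sX pX]; apply: quad_discr => [|t]; first exact: pX.
have := pX (x + t *: y); rewrite -/(bform _ _ _).
rewrite !(bformDl, bformDr, bformZl, bformZr) (bformC y x sX).
by move/le_trans; apply; rewrite le_eqVlt; apply/orP; left; apply/eqP; ring.
Qed.

Lemma psd_diag0 X i j : psd X -> X i i = 0 -> X i j = 0.
Proof.
move=> pX Xii; have := bform_CauchySchwarz (delta_mx i 0) (delta_mx j 0) pX.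
rewrite !bform_delta Xii mul0r => h; apply/eqP; rewrite -sqrf_eq0.
by rewrite eq_le h sqr_ge0.
Qed.

Lemma psd_diag_ge0 X i : psd X -> 0 <= X i i.
Proof. by case=> _ /(_ (delta_mx i 0)); rewrite -/(bform _ _ _) bform_delta. Qed.

(* Cholesky: peel off one rank-one term per row. *)
Lemma psd_gram X : psd X -> exists s : seq 'cV[R]_n, X = \sum_(x <- s) x *m x^T.
Proof.
(* Induction on the number [d] of trailing rows that may be nonzero. *)
suff gen d Y : psd Y -> (forall i j : 'I_n, (i < n - d)%N -> Y i j = 0) ->
    exists s : seq 'cV[R]_n, Y = \sum_(x <- s) x *m x^T.
  by move=> pX; apply: (gen n) => // i j; rewrite subnn.
elim: d Y => [|d IH] Y pY Y0.
  exists [::]; rewrite big_nil; apply/matrixP => i j.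
  by rewrite Y0 ?subn0 // mxE.
have [nd|dn] := leqP n d.
  apply: IH => // i j; suff -> : (n - d)%N = 0%N by [].
  by apply/eqP; rewrite subn_eq0.
have kn : (n - d.+1 < n)%N by rewrite ltn_subrL /= (leq_ltn_trans _ dn).
pose k := Ordinal kn.
have [Ykk|Ykk] := eqVneq (Y k k) 0.
  apply: IH => // i j id.
  have [|ik] := ltnP i (n - d.+1); first exact: Y0.
  suff -> : i = k by apply: psd_diag0.
  by apply/val_inj => /=; lia.
have Ykk0 : 0 < Y k k by rewrite lt_neqAle eq_sym Ykk psd_diag_ge0.
have sY : symm_mx Y by case: pY.
pose c := col k Y.
have cE i : c i 0 = Y i k by rewrite mxE.
have ccE i j : ((Y k k)^-1 *: (c *m c^T)) i j = Y i k * Y j k / Y k k.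
  by rewrite mxE mulrC; congr (_ / _); rewrite mxE big_ord1 cE mxE cE.
have YT i j : Y i j = Y j i by rewrite -{1}sY mxE.
(* This subtraction clears row [k]; Cauchy-Schwarz against the basis vector of [k] keeps the
   remainder psd. *)
have [||s sE] := IH (Y - (Y k k)^-1 *: (c *m c^T)).
- split=> [|x].
    by apply: symm_mxD => //; apply/symm_mxN/symm_mxZ; case: (psd_outer c).
  rewrite -/(bform _ _ _) bformBm bformZm bform_outer -expr2.
  have -> : bform 1%:M c x = bform Y (delta_mx k 0) x.
    by rewrite /bform mulmx1 trmx_delta -rowE -[in row _ _]sY -tr_col.
  rewrite subr_ge0 mulrC ler_pdivrMr // mulrC.
  by have := bform_CauchySchwarz (delta_mx k 0) x pY; rewrite bform_delta.
- move=> i j id; rewrite mxE [X in _ + X]mxE ccE.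
  have [ik|ik] := ltnP i (n - d.+1).
    by rewrite !(Y0 i) // !mul0r subr0.
  suff -> : i = k by rewrite (YT k j) mulrAC divff // mul1r subrr.
  by apply/val_inj => /=; lia.
exists (Num.sqrt (Y k k)^-1 *: c :: s); rewrite big_cons -sE.
rewrite linearZ /= -scalemxAl -scalemxAr scalerA -expr2 sqr_sqrtr ?invr_ge0 ?ltW //.
by rewrite addrC subrK.
Qed.

(** A Gram decomposition of [Y] turns the pairing into a sum of values of the form of [X]. *)
Lemma mdot_psd X Y : psd X -> psd Y -> 0 <= mdot X Y.
Proof.
move=> [_ pX] /psd_gram[s ->]; rewrite mdot_sumr; apply: sumr_ge0 => x _.
by rewrite mdot_outer pX.
Qed.

Lemma psd_tr_ge0 X : psd X -> 0 <= \tr X.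
Proof. by move=> pX; apply: sumr_ge0 => i _; exact: psd_diag_ge0. Qed.

(** Cauchy-Schwarz on basis vectors bounds the squared entry by [X i i * X j j], and each diagonal
    entry is at most the trace. *)
Lemma psd_entry_le X i j : psd X -> `|X i j| <= \tr X.
Proof.
move=> pX; have diag_le k : X k k <= \tr X.
  rewrite /mxtrace (bigD1 k) //= lerDl; apply: sumr_ge0 => l _.
  exact: psd_diag_ge0.
rewrite -(ler_pXn2r (ltn0Sn 1)) ?nnegrE ?psd_tr_ge0 // real_normK ?num_real //.
have := bform_CauchySchwarz (delta_mx i 0) (delta_mx j 0) pX.
rewrite !bform_delta => /le_trans; apply.
by rewrite expr2; apply: ler_pM; rewrite ?psd_diag_ge0.
Qed.

Lemma mx_entry_bound X : exists M : R, 0 <= M /\ forall i j, `|X i j| <= M.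
Proof.
exists (\sum_i \sum_j `|X i j|); split=> [|i j].
  by do 2!apply: sumr_ge0 => ? _.
rewrite (bigD1 i) //= (bigD1 j) //= -addrA lerDl addr_ge0 //.
  exact: sumr_ge0.
by do 2!apply: sumr_ge0 => ? _.
Qed.

(** Young's inequality with weight [mu] on every product of the double sum, in which each square
    occurs [n] times. *)
Lemma bform_lower (M : R) X x y (mu : R) : (forall i j, `|X i j| <= M) -> 0 < mu ->
  - (n%:R * (mu * bform 1%:M y y + M ^+ 2 / mu * bform 1%:M x x))
    <= 2 * bform X x y.
Proof.
move=> XM mu0; rewrite !bform1E [in leRHS]bformE [leRHS]mulr_sumr lerNl -sumrN.
have -> : n%:R * (mu * (\sum_j y j 0 ^+ 2) + M ^+ 2 / mu * (\sum_i x i 0 ^+ 2))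
    = \sum_(i < n) \sum_(j < n) (mu * y j 0 ^+ 2 + M ^+ 2 / mu * x i 0 ^+ 2).
  under [RHS]eq_bigr do rewrite big_split /= sumr_const card_ord -mulr_sumr.
  by rewrite big_split /= sumr_const card_ord sumrMnl -mulr_sumr -mulrnDl mulr_natl.
apply: ler_sum => i _; rewrite mulr_sumr -sumrN; apply: ler_sum => j _.
have := XM i j; set a := X i j; set u := x i 0; set v := y j 0 => aM.
have a2 : a ^+ 2 <= M ^+ 2.
  by rewrite -real_normK ?num_real // lerXn2r ?nnegrE ?(le_trans _ aM).
have : 0 <= (mu * v + a * u) ^+ 2 / mu by rewrite divr_ge0 ?sqr_ge0 // ltW.
have -> : (mu * v + a * u) ^+ 2 / mu = mu * v ^+ 2 + a ^+ 2 / mu * u ^+ 2 + 2 * (u * a * v).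
  by field; rewrite gt_eqF.
have : a ^+ 2 / mu * u ^+ 2 <= M ^+ 2 / mu * u ^+ 2.
  by rewrite ler_wpM2r ?sqr_ge0 // ler_pM2r ?invr_gt0.
lra.
Qed.

Lemma bform_upper X : exists K : R, 0 < K /\
  forall x, bform X x x <= K * bform 1%:M x x.
Proof.
have [M [M0 XM]] := mx_entry_bound (- X).
(* The last summand keeps the constant positive even for [n = 0], so that it can be inverted
   later. *)
exists (n%:R * (1 + M ^+ 2) + 1); split=> [|x].
  by rewrite ltr_wpDl // mulr_ge0 // addr_ge0 // sqr_ge0.
have := bform_lower x x XM ltr01; rewrite bformNm.
have := bform1_ge0 x; set b := bform 1%:M x x; set c := bform X x x => b0.
rewrite invr1 mulr1 mul1r.
have : 0 <= n%:R * (1 + M ^+ 2) * b by rewrite !mulr_ge0 // addr_ge0 ?sqr_ge0.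
lra.
Qed.

Lemma mdot_CauchySchwarz X Y : mdot X Y ^+ 2 <= mdot X X * mdot Y Y.
Proof.
apply: quad_discr => [|t]; first exact: mdot_ge0.
have := mdot_ge0 (X + t *: Y).
rewrite !(mdotDl, mdotDr, mdotZl, mdotZr) (mdotC Y X).
by move/le_trans; apply; rewrite le_eqVlt; apply/orP; left; apply/eqP; ring.
Qed.

(** The Frobenius norm dominates the spectral norm: Cauchy-Schwarz for [X] against [x *m x^T]. *)
Lemma psd_frobenius X (e : R) : symm_mx X -> 0 <= e -> mdot X X <= e ^+ 2 ->
  psd (X + e%:M).
Proof.
move=> sX e0 Xe; split=> [|x]; first exact/symm_mxD/symm_scalar_mx.
rewrite -/(bform _ _ _) bformDm -[e%:M]scalemx1 bformZm.
have := mdot_CauchySchwarz X (x *m x^T).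
rewrite !mdot_outer bform_outer -expr2; have := bform1_ge0 x.
set b := bform 1%:M x x; set c := bform X x x => b0 h.
suff : `|c| <= e * b by rewrite ler_norml => /andP[]; lra.
rewrite -(ler_pXn2r (ltn0Sn 1)) ?nnegrE ?mulr_ge0 // real_normK ?num_real //.
by apply: le_trans h _; rewrite exprMn ler_wpM2r ?sqr_ge0.
Qed.

(** [P] is the orthogonal projection onto the range of [X], and the last clause bounds [X] below
    there. Since [P = X *m H], Cauchy-Schwarz in the form of [X] bounds the square of [bform P x x]
    by [bform X x x] times [K * bform P x x], and one factor cancels. *)
Lemma psd_range_proj X : psd X -> exists (P : 'M[R]_n) (c : R),
  [/\ symm_mx P, P *m P = P, X *m P = X, 0 < c &
      forall x, c * bform P x x <= bform X x x].
Proof.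
move=> pX; have sX : symm_mx X by case: pX.
have [B [Bfree [D XE] [E BE]]] : exists B : 'M[R]_(\rank X, n),
    [/\ row_free B, exists D, X = D *m B & exists E, B = E *m X].
  by exists (row_base X); split; rewrite ?row_base_free //;
     apply/submxP; rewrite eq_row_base.
have Gu : B *m B^T \in unitmx.
  (* A row [u] killed by [B *m B^T] makes [u *m B] a vector of norm zero, and [B] is free. *)
  rewrite -row_free_unit -kermx_eq0; apply/eqP/row_matrixP => i.
  rewrite row0; set u := row i _.
  have u0 : u *m (B *m B^T) = 0 by apply/sub_kermxP; exact: row_sub.
  apply: (row_free_inj Bfree); rewrite mul0mx -[LHS]trmxK.
  rewrite (_ : (u *m B)^T = 0) ?trmx0 //; apply: bform1_eq0.
  by rewrite /bform mulmx1 trmxK trmx_mul mulmxA -(mulmxA u) u0 mul0mx mxE.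
pose G := invmx (B *m B^T); pose P := B^T *m G *m B.
have sG : G^T = G by rewrite trmx_inv trmx_mul trmxK.
have sP : symm_mx P by rewrite /symm_mx /P !trmx_mul trmxK sG mulmxA.
have PP : P *m P = P.
  by rewrite /P -!mulmxA (mulmxA B) (mulmxA (B *m _)) mulmxV // mul1mx.
have XP : X *m P = X.
  by rewrite {1}XE /P -mulmxA (mulmxA B) (mulmxA B) mulmxV // mul1mx -XE.
(* Chosen so that [P = X *m H]; the trailing [P] makes [H] depend on [P *m x] only. *)
pose H := E^T *m G *m B *m P.
have PXH : P = X *m H.
  by rewrite -{1}PP {1}/P BE trmx_mul sX /H -BE !mulmxA.
have [K [K0 HK]] := bform_upper (H^T *m X *m H).
exists P, K^-1; split => //; first by rewrite invr_gt0.
move=> x; rewrite mulrC ler_pdivrMr // mulrC.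
have HP : H *m P = H by rewrite /H -mulmxA PP.
have := bform_CauchySchwarz x (H *m x) pX.
have -> : bform X x (H *m x) = bform P x x by rewrite /bform PXH !mulmxA.
have bPE : bform P x x = bform 1%:M (P *m x) (P *m x).
  by rewrite -bform_mul mulmx1 sP PP.
have := HK (P *m x); rewrite bform_mul -bPE mulmxA HP.
have : 0 <= bform P x x by rewrite bPE bform1_ge0.
have : 0 <= bform X x x by exact: (pX.2 x).
set p := bform P x x; set a := bform X x x; set h := bform X _ _ => a0 p0 h1 h2.
have {h1 h2} hp : p ^+ 2 <= a * (K * p) by apply: le_trans h2 _; rewrite ler_wpM2l.
move: p0; rewrite le_eqVlt => /predU1P[<-|p0]; first by rewrite mulr_ge0 // ltW.
by rewrite -(ler_pM2r p0) -expr2 (le_trans hp) // le_eqVlt; apply/orP; left; apply/eqP; ring.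
Qed.
End MatrixDot.

(** * Separation of a convex set from the origin *)

Section Separation.
Context {R : realType} {N : nat}.
Implicit Types (u v w : 'rV[R]_N).

Definition rdot u v : R := \sum_i u 0 i * v 0 i.

Lemma rdotC u v : rdot u v = rdot v u.
Proof. by apply: eq_bigr => i _; rewrite mulrC. Qed.

Lemma rdotDl u v w : rdot (u + v) w = rdot u w + rdot v w.
Proof. by rewrite -big_split; apply: eq_bigr => i _; rewrite mxE mulrDl. Qed.

Lemma rdotZl a u v : rdot (a *: u) v = a * rdot u v.
Proof. by rewrite mulr_sumr; apply: eq_bigr => i _; rewrite mxE mulrA. Qed.

Lemma rdotDr u v w : rdot u (v + w) = rdot u v + rdot u w.
Proof. by rewrite rdotC rdotDl !(rdotC u). Qed.

Lemma rdotZr a u v : rdot u (a *: v) = a * rdot u v.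
Proof. by rewrite rdotC rdotZl rdotC. Qed.

Lemma rdot_ge0 u : 0 <= rdot u u.
Proof. by apply: sumr_ge0 => i _; rewrite -expr2 sqr_ge0. Qed.

Lemma rdot_sqr_continuous : continuous (fun u => rdot u u : R^o).
Proof.
apply: continuous_big => [|i _]; first exact: add_continuous.
move=> u.
have ci := @coord_continuous R 1 N 0 i u.
exact: (continuousM ci ci).
Qed.

(** The functional is the point [c] of least norm in the closure of [Q]: if [rdot c u < rdot c c], a
    short move from [c] towards [u] would decrease the norm. *)
Lemma convex_separation (Q : set 'rV[R]_N) (d : R) :
  Q !=set0 ->
  (forall u v a, Q u -> Q v -> 0 <= a <= 1 -> Q (a *: u + (1 - a) *: v)) ->
  (forall u, Q u -> d <= rdot u u) ->
  exists w, forall u, Q u -> d <= rdot w u.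
Proof.
move=> [q0 Qq0] Qconv Qd; pose f u : R := rdot u u.
have cf : continuous f by exact: rdot_sqr_continuous.
pose K := closure Q `&` [set u | f u <= f q0].
have Kcl : closed K.
  apply: closedI; first exact: closed_closure.
  by apply: (@closed_comp _ _ f [set r | r <= f q0]) => [u _|]; [exact: cf|exact: closed_le].
have Kcompact : compact K.
  (* Each squared coordinate is at most [f q0], so [K] lies in a box of half-width [f q0 + 1]. *)
  apply: (subclosed_compact Kcl (@rV_compact _ N
    (fun=> `[- (f q0 + 1), f q0 + 1]%classic) (fun=> @segment_compact _ _ _))).
  move=> u [_ /= fu] i; rewrite in_itv /= -ler_norml.
  have : u 0 i ^+ 2 <= f q0.
    apply: le_trans fu; rewrite /f /rdot (bigD1 i) //= -expr2 lerDl.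
    by apply: sumr_ge0 => j _; rewrite -expr2 sqr_ge0.
  rewrite -real_normK ?num_real //; have := normr_ge0 (u 0 i).
  set t := `|_| => t0 h; rewrite leNgt; apply/negP => ht.
  by have := rdot_ge0 q0; rewrite -/(f q0) => f0; nra.
have K0 : K !=set0 by exists q0; split=> //=; exact: subset_closure.
have [c Kc cmin] : exists2 c, c \in K & forall u, u \in K -> f c <= f u.
  by apply: compact_EVT_min => //; apply: continuous_subspaceT.
move: Kc; rewrite inE => -[cQ /= fc].
have {}cmin u : closure Q u -> f c <= f u.
  move=> uQ; have [h|/ltW h] := leP (f u) (f q0); last exact: le_trans h.
  by apply: cmin; rewrite inE.
have fcd : d <= f c.
  rewrite leNgt; apply/negP => fcd.
  have : nbhs c [set u | f u < d] by exact: (cvgr_lt (f c) (cf c) d fcd).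
  by move/cQ => [u [Qu /=]]; rewrite ltNge Qd.
exists c => u Qu; apply: le_trans fcd _.
have segm a : 0 <= a <= 1 -> closure Q (a *: u + (1 - a) *: c).
  move=> a01 B nB.
  have : nbhs c [set v | B (a *: u + (1 - a) *: v)].
    have : {for c, continuous (fun v => a *: u + (1 - a) *: v)}.
      apply: (@continuousD _ _ _ (fun=> a *: u) (fun v => (1 - a) *: v)).
        exact: cst_continuous.
      exact: scaler_continuous.
    by apply.
  by move/cQ => [v [Qv Bv]]; exists (a *: u + (1 - a) *: v); split=> //; exact: Qconv.
rewrite leNgt; apply/negP => cu.
pose D := f u - 2 * rdot c u + f c; pose s := f c - rdot c u.
have D0 : 0 <= D.
  have := rdot_ge0 (u + (-1) *: c).
  rewrite !(rdotDl, rdotDr, rdotZl, rdotZr) (rdotC u c) -/(f u) -/(f c) /D; lra.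
have s0 : 0 < s by rewrite /s subr_gt0.
(* [D] is the squared distance from [c] to [u]. A move by [a] changes the squared norm by
   [a * (a * D - 2 * s)], which is negative for this [a]. *)
pose a := Num.min 1 (s / (D + 1)).
have a0 : 0 < a by rewrite /a lt_min ltr01 divr_gt0 // ltr_wpDl.
have a1 : a <= 1 by rewrite /a ge_min lexx.
have aD : a * (D + 1) <= s.
  by rewrite -ler_pdivlMr ?ltr_wpDl // /a ge_min lexx orbT.
have := cmin _ (segm a _); rewrite (ltW a0) a1 => /(_ isT).
rewrite {2}/f !(rdotDl, rdotDr, rdotZl, rdotZr) (rdotC u c) -/(f u) -/(f c) => h.
have {h} : 0 <= a * (a * D - 2 * s).
  by rewrite /D /s; move: h; set x := f c; set y := f u; set z := rdot c u; nra.
rewrite pmulr_rge0 //; nra.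
Qed.
End Separation.

Lemma mdot_mxvec (R : realType) (n : nat) (X Y : 'M[R]_n) :
  mdot X Y = rdot (mxvec X) (mxvec Y).
Proof.
rewrite mdotE pair_bigA /rdot (reindex _ (curry_mxvec_bij _ _)) /=.
by apply: eq_bigr => -[i j] _; rewrite /= !mxvecE.
Qed.

(** * Weak, asymptotic and strong duality for a semidefinite pair *)

Section Values.
Context {R : realType} {n m : nat}.
Variables (C : 'M[R]_n) (A : 'I_m -> 'M[R]_n) (b : 'I_m -> R).
Implicit Types (X Z : 'M[R]_n) (y : 'I_m -> R).

Lemma mdot_dual_slack X y : (forall i, mdot (A i) X = b i) ->
  mdot (dual_slack C A y) X = mdot C X - \sum_i b i * y i.
Proof.
move=> AX; rewrite mdotBl mdot_suml; congr (_ - _); apply: eq_bigr => i _.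
by rewrite mdotZl AX mulrC.
Qed.

Lemma weak_duality X y : psd X -> (forall i, mdot (A i) X = b i) ->
  psd (dual_slack C A y) -> \sum_i b i * y i <= mdot C X.
Proof. by move=> pX AX pZ; rewrite -subr_ge0 -mdot_dual_slack // mdot_psd. Qed.

Let pset := [set mdot C X | X in [set X | psd X /\ forall i, mdot (A i) X = b i]].

Let pset_has_lbound : dual_feasible C A -> has_lbound pset.
Proof.
move=> [y py]; exists (\sum_i b i * y i) => _ [X [pX AX] <-].
exact: weak_duality.
Qed.

Lemma vP_le X : dual_feasible C A -> psd X -> (forall i, mdot (A i) X = b i) ->
  vP C A b <= mdot C X.
Proof. by move=> /pset_has_lbound lb pX AX; apply: ge_inf => //; exists X. Qed.

Lemma vP_ge (r : R) : primal_feasible A b ->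
  (forall X, psd X -> (forall i, mdot (A i) X = b i) -> r <= mdot C X) ->
  r <= vP C A b.
Proof.
move=> [X [pX AX]] h; apply: lb_le_inf; first by exists (mdot C X), X.
by move=> _ [Y [pY AY] <-]; exact: h.
Qed.

Lemma vP_approx (e : R) : primal_feasible A b -> dual_feasible C A -> 0 < e ->
  exists X, [/\ psd X, forall i, mdot (A i) X = b i & mdot C X < vP C A b + e].
Proof.
move=> [X [pX AX]] /pset_has_lbound lb e0.
have [_ [Y [pY AY] <-] Ye] : exists2 r, pset r & r < inf pset + e.
  by apply: inf_adherent => //; split=> //; exists (mdot C X), X.
by exists Y.
Qed.

Lemma dual_slack_comb (a c : R) y z : a + c = 1 ->
  dual_slack C A (fun i => a * y i + c * z i) =
  a *: dual_slack C A y + c *: dual_slack C A z.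
Proof.
move=> ac; rewrite /dual_slack !scalerBr addrACA -scalerDl ac scale1r -opprD.
congr (_ - _); rewrite !scaler_sumr -big_split; apply: eq_bigr => i _.
by rewrite !scalerA scalerDl.
Qed.

Lemma symm_dual_slack y : symm_mx C -> (forall i, symm_mx (A i)) ->
  symm_mx (dual_slack C A y).
Proof.
by move=> sC sA; apply/symm_mxD/symm_mxN/symm_mx_sum => // i; exact: symm_mxZ.
Qed.

(** Encodes a slack and an objective value as one vector, to which [convex_separation] applies. *)
Let pack Z (r : R) : 'rV[R]_(n * n + 1) := row_mx (mxvec Z) (const_mx r).

Let rdot_pack Z Z' r r' : rdot (pack Z r) (pack Z' r') = mdot Z Z' + r * r'.
Proof.
rewrite /rdot big_split_ord /= big_ord1 !row_mxEr !mxE; congr (_ + _).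
under eq_bigr do rewrite !row_mxEl.
by rewrite mdot_mxvec.
Qed.

Let pack_surj u : exists Z r, u = pack Z r.
Proof.
exists (vec_mx (lsubmx u)), (rsubmx u 0 0); rewrite /pack vec_mxK -[LHS]hsubmxK.
by congr row_mx; apply/rowP => i; rewrite !mxE (ord1 i).
Qed.

Let packD a c Z Z' r r' :
  a *: pack Z r + c *: pack Z' r' = pack (a *: Z + c *: Z') (a * r + c * r').
Proof.
rewrite /pack !scale_row_mx add_row_mx -!linearZ -linearD; congr row_mx.
by apply/rowP => i; rewrite !mxE.
Qed.

Lemma linear_bounded_eq0 (a k : R) : (forall t, t * a <= k) -> a = 0.
Proof.
move=> h; apply/eqP/negPn/negP => a0.
by have := h ((k + 1) / a); rewrite divfK //; lra.
Qed.

Lemma linear_bounded_ge0 (a k : R) : (forall t, 0 <= t -> - (t * a) <= k) -> 0 <= a.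
Proof.
move=> h; rewrite leNgt; apply/negP => a0.
have k0 : 0 <= k by have := h 0 (lexx _); rewrite mul0r oppr0.
have := h (- ((k + 1) / a)); rewrite mulNr divfK ?lt_eqF // opprK oppr_ge0.
have -> : (k + 1) / a <= 0 by rewrite ler_ndivrMr // mul0r; lra.
by move=> /(_ isT); lra.
Qed.

(* If no [y] worked, the convex set of all [(C - sum y_i A_i - S, b y - r)] with
   [S] psd and [r >= 0] would stay away from [(0, vP - e)]; a separating
   functional [(X, s)] then yields a primal feasible point of value below [vP]
   (if [s > 0]) or an improving primal ray (if [s = 0]). *)
Lemma asymptotic_duality (e : R) : symm_mx C -> (forall i, symm_mx (A i)) ->
  primal_feasible A b -> dual_feasible C A -> 0 < e ->
  exists y, psd (dual_slack C A y + e%:M) /\ vP C A b - 2 * e <= \sum_i b i * y i.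
Proof.
move=> sC sA fP fD e0; apply: contrapT => noy.
pose bt y := \sum_i b i * y i; set p := vP C A b.
pose Q := [set u | exists y S r, [/\ psd S, 0 <= r &
  u = pack (dual_slack C A y - S) (bt y - r - (p - e))]].
have e20 : 0 < e ^+ 2 by rewrite exprn_gt0.
have [||u [y [S [r [pS r0 ->]]]]|w wsep] := @convex_separation _ _ Q (e ^+ 2).
- by exists (pack (dual_slack C A (fun=> 0) - 0) (bt (fun=> 0) - 0 - (p - e)));
    exists (fun=> 0), 0, 0; split=> //; exact: psd0.
- move=> _ _ a [y [S [r [pS r0 ->]]]] [z [S' [r' [pS' r0' ->]]]] /andP[a0 a1].
  exists (fun i => a * y i + (1 - a) * z i), (a *: S + (1 - a) *: S'),
    (a * r + (1 - a) * r'); split.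
  + by apply: psdD; apply: psdZ => //; rewrite subr_ge0.
  + by rewrite addr_ge0 ?mulr_ge0 // subr_ge0.
  rewrite packD dual_slack_comb ?subrKC //; congr pack.
    by rewrite !scalerBr opprD addrACA.
  have -> : bt (fun i => a * y i + (1 - a) * z i) = a * bt y + (1 - a) * bt z.
    by rewrite /bt !mulr_sumr -big_split; apply: eq_bigr => i _ /=; ring.
  ring.
(* A point of [Q] of norm below [e] makes its [y] a solution: the slack is psd up to [e] in
   Frobenius norm, and the value is within [2 * e] of [p]. *)
- rewrite rdot_pack leNgt; apply/negP => lt_e; apply: noy; exists y.
  set Z := dual_slack C A y - S in lt_e; set t := bt y - r - (p - e) in lt_e.
  have t2 : 0 <= t * t by rewrite -expr2 sqr_ge0.
  have Z2 : 0 <= mdot Z Z by exact: mdot_ge0.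
  split.
    have -> : dual_slack C A y + e%:M = (Z + e%:M) + S by rewrite [RHS]addrAC subrK.
    apply: psdD => //; apply: psd_frobenius; rewrite ?ltW //; last by nra.
    by apply: symm_mxD; [exact: symm_dual_slack|apply: symm_mxN; case: pS].
  rewrite -/(bt y); have : - e <= t by rewrite leNgt; apply/negP => te; nra.
  by rewrite /t; lra.
have [X0 [s wE]] := pack_surj (- w).
have {wsep} sep y S r : psd S -> 0 <= r ->
    mdot X0 (dual_slack C A y - S) + s * (bt y - r - (p - e)) <= - e ^+ 2.
  move=> pS r0; rewrite -rdot_pack -wE -[- w]scaleN1r rdotZl mulN1r lerN2.
  by apply: wsep; exists y, S, r.
pose X := sympart X0.
have XE Z : symm_mx Z -> mdot X Z = mdot X0 Z by exact: mdot_sympart.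
have sX : symm_mx X by exact: symm_sympart.
have {}sep y S r : psd S -> 0 <= r ->
    mdot X (dual_slack C A y - S) + s * (bt y - r - (p - e)) <= - e ^+ 2.
  move=> pS r0; rewrite XE; first exact: sep.
  by apply: symm_mxD; [exact: symm_dual_slack|apply: symm_mxN; case: pS].
have dse y : mdot X (dual_slack C A y) = mdot X C - \sum_i y i * mdot X (A i).
  by rewrite mdotBr mdot_sumr; congr (_ - _); apply: eq_bigr => i _; rewrite mdotZr.
have ds0 : mdot X (dual_slack C A (fun=> 0)) = mdot X C.
  by rewrite dse big1 ?subr0 // => i _; rewrite mul0r.
have bt0 : bt (fun=> 0) = 0 by rewrite /bt big1 // => i _; rewrite mulr0.
have sep0 S r : psd S -> 0 <= r ->
    mdot X C - mdot X S + s * (- r - (p - e)) <= - e ^+ 2.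
  by move=> pS r0; have := sep (fun=> 0) S r pS r0; rewrite mdotBr ds0 bt0 sub0r.
(* The inequality holds for arbitrarily large [S], [r] and [y]; this forces the signs of [X] and [s]
   and the equations [AX]. *)
have pX : psd X.
  split=> // x; rewrite -/(bform _ _ _) -mdot_outer.
  apply: (@linear_bounded_ge0 _ (- e ^+ 2 - mdot X C + s * (p - e))) => t t0.
  have := sep0 _ 0 (psdZ t0 (psd_outer x)) (lexx _); rewrite mdotZr; lra.
have s0 : 0 <= s.
  apply: (@linear_bounded_ge0 _ (- e ^+ 2 - mdot X C + s * (p - e))) => t t0.
  have := sep0 0 t psd0 t0; rewrite mdot0r; lra.
have AX i : mdot X (A i) = s * b i.
  apply/eqP; rewrite eq_sym -subr_eq0; apply/eqP.
  apply: (@linear_bounded_eq0 _ (- e ^+ 2 - mdot X C + s * (p - e))) => t.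
  have := sep (fun j => if j == i then t else 0) 0 0 psd0 (lexx _).
  rewrite subr0 dse (bigD1 i) //= eqxx big1 => [|j /negPf ->]; last by rewrite mul0r.
  rewrite /bt (bigD1 i) //= eqxx big1 => [|j /negPf ->]; last by rewrite mulr0.
  by lra.
have := sep0 0 0 psd0 (lexx _); rewrite mdot0r => main.
move: s0; rewrite le_eqVlt => /predU1P[s0|s0].
  have [X1 [pX1 AX1]] := fP.
  have CX : mdot X C < 0 by move: main; rewrite -s0; lra.
  suff : 0 <= mdot X C by rewrite leNgt CX.
  apply: (@linear_bounded_ge0 _ (mdot X1 C - p)) => t t0.
  rewrite lerBrDr addrC -lerBrDr opprK -mdotZl -mdotDl mdotC.
  apply: vP_le => //; first exact/psdD/psdZ.
  by move=> i; rewrite mdotDr mdotZr AX1 (mdotC _ X) AX -s0 mul0r mulr0 addr0.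
have : p <= mdot C (s^-1 *: X).
  apply: vP_le => //; first by apply: psdZ => //; rewrite invr_ge0 ltW.
  by move=> i; rewrite mdotZr mdotC AX mulKf // gt_eqF.
rewrite mdotZr mulrC ler_pdivlMr // mdotC; nra.
Qed.

(** A nearly feasible [y] of nearly optimal value is averaged with the strictly feasible [y1]:
    weight [l = e / k] on [y1] compensates the defect [e] of [y]. *)
Lemma strong_duality (y1 : 'I_m -> R) (k d : R) :
  symm_mx C -> (forall i, symm_mx (A i)) -> primal_feasible A b ->
  0 < k -> psd (dual_slack C A y1 - k%:M) -> 0 < d ->
  exists y, psd (dual_slack C A y) /\ vP C A b - d <= \sum_i b i * y i.
Proof.
move=> sC sA fP k0 py1 d0.
have py1' : psd (dual_slack C A y1).
  by rewrite -[X in psd X](subrK k%:M); apply/psdD/psd_scalar/ltW.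
have fD : dual_feasible C A by exists y1.
set p := vP C A b; pose v1 := \sum_i b i * y1 i.
have v1p : v1 <= p by apply: vP_ge => // X pX AX; exact: weak_duality.
have h0 : 0 <= (p - v1) / k by rewrite divr_ge0 ?subr_ge0 // ltW.
(* Makes the loss [2 * e] of [y] plus the loss [l * (p - v1)] of [y1] equal to [d]. *)
pose e := d / (2 + (p - v1) / k).
have e0 : 0 < e by rewrite divr_gt0 // ltr_wpDr.
have eE : 2 * e + e / k * (p - v1) = d.
  rewrite [_ / k * _]mulrAC -mulrA [2 * e]mulrC -mulrDr divfK //.
  by rewrite gt_eqF // ltr_wpDr.
have [y [py yp]] := asymptotic_duality sC sA fP fD e0.
pose l := e / k; have l0 : 0 < l by rewrite divr_gt0.
have l1 : 0 < 1 + l by rewrite ltr_wpDl.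
exists (fun i => (1 + l)^-1 * y i + (l / (1 + l)) * y1 i); split.
  rewrite dual_slack_comb; last by field; rewrite gt_eqF.
  have -> : (1 + l)^-1 *: dual_slack C A y + (l / (1 + l)) *: dual_slack C A y1 =
      (1 + l)^-1 *: (dual_slack C A y + e%:M + l *: (dual_slack C A y1 - k%:M)).
    have -> : e = l * k by rewrite divfK // gt_eqF.
    move: (dual_slack C A y) (dual_slack C A y1) => Y Y1; apply/matrixP => i j.
    by rewrite !mxE; case: (i == j); rewrite ?mulr1n ?mulr0n; field; rewrite gt_eqF.
  by apply: psdZ; [rewrite invr_ge0 ltW|apply: psdD => //; apply: psdZ => //; exact: ltW].
have -> : \sum_i b i * ((1 + l)^-1 * y i + l / (1 + l) * y1 i) =
    ((\sum_i b i * y i) + l * v1) / (1 + l).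
  rewrite /v1 mulr_sumr -big_split mulr_suml; apply: eq_bigr => i _ /=.
  by field; rewrite gt_eqF.
rewrite ler_pdivlMr //; move: yp eE l0; rewrite -/l -/p => yp eE l0.
nra.
Qed.
End Values.

(** * Eventual truth of first-order formulas to the right of zero *)

Section EventualSign.
Context {R : realType}.
Import ordered_qelim.
Implicit Types (f : ord.formula R).

(** The filter [0^'+] with an explicit radius; [right0_near] and [near_right0] translate. *)
Definition right0 (P : R -> Prop) := exists2 d : R, 0 < d & forall t, 0 < t < d -> P t.

Lemma right0I (P Q : R -> Prop) : right0 P -> right0 Q -> right0 (fun t => P t /\ Q t).
Proof.
move=> [d d0 Pd] [e e0 Qe]; exists (Num.min d e); first by rewrite lt_min d0.
by move=> t; rewrite lt_min => /and3P[t0 td te]; split; [apply: Pd|apply: Qe]; rewrite t0.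
Qed.

Lemma right0S (P Q : R -> Prop) : (forall t, 0 < t -> P t -> Q t) -> right0 P -> right0 Q.
Proof.
by move=> PQ [d d0 Pd]; exists d => // t /[dup] /andP[t0 _] /Pd; exact: PQ.
Qed.

Lemma right0T (P : R -> Prop) : (forall t, 0 < t -> P t) -> right0 P.
Proof. by move=> h; exists 1 => // t /andP[/h]. Qed.

Lemma right0_near (P : R -> Prop) : right0 P -> \forall t \near 0^'+, P t.
Proof.
move=> [d d0 Pd]; near=> t; apply: Pd; apply/andP; split.
  by near: t; exact: nbhs_right_gt.
by near: t; exact: nbhs_right_lt.
Unshelve. all: by end_near. Qed.

(** A nonzero polynomial keeps its sign between [0] and its next root. *)
Lemma poly_sgr_right0 (p : {poly R}) : exists s, right0 (fun t => Num.sg p.[t] = s).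
Proof.
have [->|p0] := eqVneq p 0.
  by exists 0; apply: right0T => t _; rewrite horner0 sgr0.
have [y] := @polyrcf.neighpr_wit R p 0 1 ltr01 p0.
rewrite /polyrcf.neighpr => hy; exists (polyrcf.sgp_right p 0), (polyrcf.next_root p 0 1).
  by move: hy; rewrite in_itv /= => /andP[]; exact: lt_trans.
by move=> t ht; apply: (@polyrcf.sgr_neighpr R 1); rewrite /polyrcf.neighpr in_itv.
Qed.

Lemma rterm_horner (u : GRing.term R) : GRing.rterm u ->
  exists p : {poly R}, forall t, GRing.eval [:: t] u = p.[t].
Proof.
elim: u => //=.
- move=> [|k] _; first by exists 'X => t; rewrite hornerX.
  (* A variable beyond the environment has the default value [0]. *)
  by exists 0 => t; rewrite horner0 /= nth_nil.
- by move=> c _; exists c%:P => t; rewrite hornerC.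
- by move=> k _; exists k%:R%:P => t; rewrite hornerC.
- move=> u IHu v IHv /andP[/IHu[p pE] /IHv[q qE]].
  by exists (p + q) => t; rewrite hornerD pE qE.
- by move=> u IHu /IHu[p pE]; exists (- p) => t; rewrite hornerN pE.
- by move=> u IHu k /IHu[p pE]; exists (p *+ k) => t; rewrite hornerMn pE.
- move=> u IHu v IHv /andP[/IHu[p pE] /IHv[q qE]].
  by exists (p * q) => t; rewrite hornerM pE qE.
by move=> u IHu k /IHu[p pE]; exists (p ^+ k) => t; rewrite horner_exp pE.
Qed.

Lemma rterms_sgr_right0 (u v : GRing.term R) : GRing.rterm u && GRing.rterm v ->
  exists s, right0 (fun t => Num.sg (GRing.eval [:: t] u - GRing.eval [:: t] v) = s).
Proof.
move=> /andP[/rterm_horner[p pE] /rterm_horner[q qE]].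
have [s hs] := poly_sgr_right0 (p - q); exists s.
by apply: right0S hs => t _ <-; rewrite hornerD hornerN pE qE.
Qed.

Lemma qf_eval_right0 f : ord.qf_form f && ord.rformula f ->
  exists v : bool, right0 (fun t => ord.qf_eval [:: t] f = v).
Proof.
have bin (op : bool -> bool -> bool) f1 f2 :
    (exists v : bool, right0 (fun t => ord.qf_eval [:: t] f1 = v)) ->
    (exists v : bool, right0 (fun t => ord.qf_eval [:: t] f2 = v)) ->
    exists v : bool,
      right0 (fun t => op (ord.qf_eval [:: t] f1) (ord.qf_eval [:: t] f2) = v).
  move=> [v1 h1] [v2 h2]; exists (op v1 v2).
  by apply: right0S (right0I h1 h2) => t _ [-> ->].
elim: f => //=.
- by move=> v _; exists v; apply: right0T.
- move=> u v /rterms_sgr_right0[s hs]; exists (s == 0).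
  by apply: right0S hs => t _ <-; rewrite sgr_eq0 subr_eq0.
- move=> u v /rterms_sgr_right0[s hs]; exists (s < 0).
  by apply: right0S hs => t _ <-; rewrite sgr_lt0 subr_lt0.
- move=> u v /rterms_sgr_right0[s hs]; exists (s <= 0).
  by apply: right0S hs => t _ <-; rewrite sgr_le0 subr_le0.
- move=> f IHf g IHg /andP[/andP[qf qg] /andP[rf rg]].
  by apply: (bin andb); [apply: IHf; rewrite qf|apply: IHg; rewrite qg].
- move=> f IHf g IHg /andP[/andP[qf qg] /andP[rf rg]].
  by apply: (bin orb); [apply: IHf; rewrite qf|apply: IHg; rewrite qg].
- move=> f IHf g IHg /andP[/andP[qf qg] /andP[rf rg]].
  by apply: (bin implb); [apply: IHf; rewrite qf|apply: IHg; rewrite qg].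
- move=> f IHf /IHf[v hv]; exists (~~ v).
  by apply: right0S hv => t _ ->.
Qed.

(* Quantifier elimination turns [f] into a boolean combination of polynomial
   sign conditions in [t]. *)
Lemma holds_right0 f :
  right0 (fun t => ord.holds [:: t] f) \/ right0 (fun t => ~ ord.holds [:: t] f).
Proof.
pose g := ord.quantifier_elim
  (fun i bc => qe_rcf.qfr_to_formula (qe_rcf.wproj i bc)) (ord.to_rform f).
have gE t : reflect (ord.holds [:: t] f) (ord.qf_eval [:: t] g).
  exact: qe_rcf.rcf_satP.
have : ord.qf_form g && ord.rformula g.
  by apply: ord.quantifier_elim_wf; [exact: qe_rcf.wf_QE_wproj|exact: ord.to_rform_rformula].
by move=> /qf_eval_right0[[] h]; [left|right]; apply: right0S h => t _ /gE.
Qed.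

(** Quantifying the variables just after the environment extends it, because [set_nth] at position
    [size e] is [rcons]. *)
Lemma holds_existsn f k e :
  ord.holds e (foldr (@ord.Exists R) f (iota (size e) k)) <->
  exists2 s, size s = k & ord.holds (e ++ s) f.
Proof.
elim: k e => [|k IH] e /=.
  split=> [h|[s /size0nil ->]]; last by rewrite cats0.
  by exists [::]; rewrite ?cats0.
have setE x : set_nth 0 e (size e) x = rcons e x by elim: (e) => //= z e' ->.
split=> [[x]|[[//|x s] [sk] h]].
  rewrite setE -(size_rcons e x) => /IH[s sk h].
  by exists (x :: s); rewrite /= ?sk // -cat_rcons.
by exists x; rewrite setE -(size_rcons e x); apply/IH; exists s; rewrite ?cat_rcons.
Qed.

Lemma holds_foralln f k e :
  ord.holds e (foldr (@ord.Forall R) f (iota (size e) k)) <->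
  forall s, size s = k -> ord.holds (e ++ s) f.
Proof.
elim: k e => [|k IH] e /=.
  split=> [h s /size0nil ->|/(_ [::] erefl)]; by rewrite cats0.
have setE x : set_nth 0 e (size e) x = rcons e x by elim: (e) => //= z e' ->.
split=> [h [//|x s] [sk]|h x].
  by have := h x; rewrite setE -(size_rcons e x) => /IH/(_ s sk); rewrite cat_rcons.
rewrite setE -(size_rcons e x); apply/IH => s sk.
by rewrite cat_rcons; apply: h; rewrite /= sk.
Qed.

Lemma holds_Equal e (u v : GRing.term R) :
  ord.holds e (ord.Equal u v) = (GRing.eval e u = GRing.eval e v).
Proof. by []. Qed.

Lemma holds_and_all (I : finType) (F : I -> ord.formula R) e :
  ord.holds e (foldr (fun i => ord.And (F i)) (ord.Bool true) (enum I)) <->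
  forall i, ord.holds e (F i).
Proof.
suff gen (r : seq I) :
    ord.holds e (foldr (fun i => ord.And (F i)) (ord.Bool true) r) <->
    {in r, forall i, ord.holds e (F i)}.
  by rewrite gen; split=> [h i|h i _]; apply: h; rewrite mem_enum.
elim: r => //= j r IH; rewrite IH; split=> [[h1 h2] i|h].
  by rewrite inE => /predU1P[->|/h2].
split=> [|i ir]; apply: h; first exact: mem_head.
by rewrite inE ir orbT.
Qed.

Definition tsum (I : finType) (F : I -> GRing.term R) : GRing.term R :=
  foldr (fun i => GRing.Add (F i)) (GRing.NatConst R 0) (enum I).

Lemma eval_tsum (I : finType) (F : I -> GRing.term R) e :
  GRing.eval e (tsum F) = \sum_i GRing.eval e (F i).
Proof.
rewrite /tsum -big_enum /=; elim: (enum I) => [|i r IH] /=; first by rewrite big_nil.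
by rewrite big_cons IH.
Qed.

(** The limit is the supremum of the eventual lower bounds; the dichotomy, applied slightly above
    it, excludes oscillation. *)
Lemma cvg_right0 (phi : R -> R) (M : R) :
  right0 (fun t => - M <= phi t <= M) ->
  (forall c, right0 (fun t => phi t < c) \/ right0 (fun t => ~ (phi t < c))) ->
  exists l : R, phi t @[t --> 0^'+] --> (l : R^o).
Proof.
move=> hM hc; pose L := [set c | right0 (fun t => c <= phi t)].
have L0 : L (- M) by apply: right0S hM => t _ /andP[].
have LM : ubound L M.
  move=> c hL; have [d d0 /(_ (d / 2))] := right0I hL hM.
  have -> : 0 < d / 2 < d by apply/andP; split; lra.
  by move=> /(_ isT)[h1 /andP[_ h2]]; exact: le_trans h2.
have sL : has_sup L by split; [exists (- M)|exists M].
exists (sup L); apply/cvgrPdist_lt => e e0.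
apply: right0_near.
have [c Lc ce] := sup_adherent e0 sL.
have lt_e : right0 (fun t => phi t < sup L + e / 2).
  have [//|h] := hc (sup L + e / 2).
  have : L (sup L + e / 2) by apply: right0S h => t _ /negP; rewrite -leNgt.
  move=> /(sup_ubound sL.2); lra.
apply: right0S (right0I Lc lt_e) => t _ [h1 h2].
by rewrite ltr_norml; apply/andP; split; lra.
Qed.
End EventualSign.

(** * First-order definability of the regularized value *)

Section RegularizedDefinable.
Context {R : realType} {n m : nat}.
Import ordered_qelim.
Variables (C : 'M[R]_n) (A : 'I_m -> 'M[R]_n) (b : 'I_m -> R).

(** Variable [0] is [t], the next [n * n] are the entries of the matrix, and the [n] after those are
    the test vector of the psd condition. *)
Let vX (i j : 'I_n) : GRing.term R := GRing.Var R (mxvec_index i j).+1.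
Let vx (i : 'I_n) : GRing.term R := GRing.Var R (n * n + i).+1.
Let tdot (F : 'M[R]_n) : GRing.term R :=
  tsum (fun i => tsum (fun j => GRing.Mul (GRing.Const (F i j)) (vX i j))).
Let mxof (s : seq R) : 'M[R]_n := \matrix_(i, j) s`_(mxvec_index i j).

Let eval_vX t s r i j : size s = (n * n)%N ->
  GRing.eval (t :: s ++ r) (vX i j) = mxof s i j.
Proof. move=> sz; rewrite -[GRing.eval _ _]/((s ++ r)`_(mxvec_index i j)).
by rewrite nth_cat sz ltn_ord mxE. Qed.

Let eval_tdot t s F : size s = (n * n)%N ->
  GRing.eval (t :: s) (tdot F) = mdot F (mxof s).
Proof.
move=> sz; rewrite mdotE eval_tsum; apply: eq_bigr => i _.
rewrite eval_tsum; apply: eq_bigr => j _.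
by rewrite -(eval_vX t [::] i j sz) cats0.
Qed.

Let fsym : ord.formula R := foldr (fun i => ord.And
  (foldr (fun j => ord.And (ord.Equal (vX i j) (vX j i))) (ord.Bool true) (enum 'I_n)))
  (ord.Bool true) (enum 'I_n).

Let fquad : ord.formula R := foldr (@ord.Forall R)
  (ord.Le (GRing.NatConst R 0) (tsum (fun i => tsum (fun j =>
     GRing.Mul (GRing.Mul (vx i) (vX i j)) (vx j)))))
  (iota (n * n).+1 n).

Let holds_psd t s : size s = (n * n)%N ->
  ord.holds (t :: s) (ord.And fsym fquad) <-> psd (mxof s).
Proof.
move=> sz; have szt : size (t :: s) = (n * n).+1 by rewrite /= sz.
have evalE i j : GRing.eval (t :: s) (vX i j) = mxof s i j.
  by rewrite -(eval_vX t [::] i j sz) cats0.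
have symP : ord.holds (t :: s) fsym <-> symm_mx (mxof s).
  rewrite /fsym holds_and_all; split=> [h|h i].
    apply/matrixP => i j; rewrite mxE; have /holds_and_all/(_ i) := h j.
    by rewrite holds_Equal !evalE.
  by apply/holds_and_all => j; rewrite holds_Equal !evalE -{1}h mxE.
have quadP : ord.holds (t :: s) fquad <-> forall x, 0 <= bform (mxof s) x x.
  rewrite /fquad -szt holds_foralln.
  have quadE r : size r = n -> GRing.eval (t :: s ++ r) (tsum (fun i => tsum (fun j =>
     GRing.Mul (GRing.Mul (vx i) (vX i j)) (vx j)))) =
     bform (mxof s) (\col_i r`_i) (\col_i r`_i).
    move=> szr; have vxE i : GRing.eval (t :: s ++ r) (vx i) = (\col_i r`_i) i 0.
      by rewrite /= nth_cat sz ltnNge leq_addr /= addKn mxE.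
    rewrite eval_tsum bformE; apply: eq_bigr => i _; rewrite eval_tsum.
    apply: eq_bigr => j _; rewrite -(vxE i) -(vxE j) -(eval_vX t r _ _ sz).
    by [].
  split=> [h x|h r szr].
    have szx : size [tuple x i 0 | i < n] = n by rewrite size_tuple.
    have := h [tuple x i 0 | i < n] szx; rewrite /= quadE //.
    suff -> : \col_i [tuple x i 0 | i < n]`_i = x by [].
    by apply/colP => i; rewrite mxE nth_mktuple.
  by rewrite /= quadE.
by rewrite /= symP quadP.
Qed.

(** An infimum is below [c] as soon as one feasible point has value below [c], so this existential
    formula stands for [vreg < c]. *)
Lemma feasible_value_definable (al be c : R) : exists f : ord.formula R, forall t : R,
  ord.holds [:: t] f <-> exists X, [/\ psd X,
    forall i, mdot (A i) X = b i + (t * be) * mdot (A i) 1%:M &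
    mdot (C + (t * al)%:M) X < c].
Proof.
pose v0 : GRing.term R := GRing.Var R 0.
pose fcon : ord.formula R := foldr (fun i => ord.And (ord.Equal (tdot (A i))
  (GRing.Add (GRing.Const (b i)) (GRing.Mul v0 (GRing.Const (be * mdot (A i) 1%:M))))))
  (ord.Bool true) (enum 'I_m).
pose fobj : ord.formula R := ord.Lt
  (GRing.Add (tdot C) (GRing.Mul v0 (GRing.Mul (GRing.Const al) (tdot 1%:M))))
  (GRing.Const c).
exists (foldr (@ord.Exists R)
  (ord.And (ord.And fsym fquad) (ord.And fcon fobj)) (iota 1 (n * n))) => t.
rewrite -[1%N]/(size [:: t]) holds_existsn.
have conP s : size s = (n * n)%N -> ord.holds (t :: s) fcon <->
    forall i, mdot (A i) (mxof s) = b i + (t * be) * mdot (A i) 1%:M.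
  move=> sz; rewrite /fcon holds_and_all.
  by split=> h i; have := h i; rewrite /= eval_tdot // mulrA.
have objP s : size s = (n * n)%N -> ord.holds (t :: s) fobj <->
    mdot (C + (t * al)%:M) (mxof s) < c.
  move=> sz; rewrite /= !eval_tdot // mdotDl -[(t * al)%:M]scalemx1 mdotZl.
  by rewrite mulrA.
split=> [[s sz [/(holds_psd t sz) h1 [/(conP s sz) h2 /(objP s sz) h3]]]|[X [h1 h2 h3]]].
  by exists (mxof s).
pose s : seq R := [tuple mxvec X 0 k | k < n * n].
have sz : size s = (n * n)%N by rewrite size_tuple.
have sX : mxof s = X.
  by apply/matrixP => i j; rewrite mxE nth_mktuple mxvecE.
by exists s => //; split; [apply/holds_psd|split; [apply/conP|apply/objP]]; rewrite ?sX.
Qed.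
End RegularizedDefinable.

(** * The error bound under singularity degree one *)

Section ErrorBound.
Context {R : realType} {n : nat}.
Implicit Types (X Y Z P W : 'M[R]_n) (x : 'cV[R]_n).

(** A generalized inverse of the linear map sending [X] to all [mdot (F k) X] picks a solution that
    depends linearly on these values. *)
Lemma bounded_preimage (T : finType) (F : T -> 'M[R]_n) : exists K : R, 0 <= K /\
  forall X (B : R), 0 <= B -> (forall k, `|mdot (F k) X| <= B) ->
  exists W, (forall k, mdot (F k) W = mdot (F k) X) /\ forall i j, `|W i j| <= K * B.
Proof.
pose L : 'M[R]_(n * n, #|T|) := \matrix_(p, k) mxvec (F (enum_val k)) 0 p.
have LE Y k : (mxvec Y *m L) 0 k = mdot (F (enum_val k)) Y.
  by rewrite mxE mdotC mdot_mxvec; apply: eq_bigr => p _; rewrite !mxE.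
pose H := pinvmx L; pose K : R := \sum_p \sum_k `|H k p|.
exists K; split=> [|X B B0 XB]; first by do 2!apply: sumr_ge0 => ? _.
pose u := mxvec X *m L; exists (vec_mx (u *m H)); split=> [k|i j].
  have := LE (vec_mx (u *m H)) (enum_rank k).
  rewrite vec_mxK mulmxKpV ?submxMl // LE enum_rankK.
  by [].
rewrite mxE mxE (le_trans (ler_norm_sum _ _ _)) //.
set p := mxvec_index i j.
apply: (@le_trans _ _ (\sum_k `|H k p| * B)).
  apply: ler_sum => k _; rewrite normrM mulrC ler_wpM2l //.
  by rewrite LE.
rewrite -mulr_suml ler_wpM2r // /K (bigD1 p) //= lerDl.
by do 2!apply: sumr_ge0 => ? _.
Qed.

Lemma psd_proj P : symm_mx P -> P *m P = P -> psd P.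
Proof.
move=> sP PP; split=> // x.
by rewrite -/(bform _ _ _) -PP -{1}sP -[P^T]mulmx1 bform_mul bform1_ge0.
Qed.

Lemma mdot_conj P X Y : symm_mx P -> mdot (P *m Y *m P) X = mdot Y (P *m X *m P).
Proof.
move=> sP; rewrite /mdot !trmx_mul sP mxtrace_mulC !mulmxA mxtrace_mulC.
by rewrite !mulmxA mxtrace_mulC !mulmxA.
Qed.

Lemma sympart_conj P X : symm_mx P -> P *m sympart X *m P = sympart (P *m X *m P).
Proof.
move=> sP; rewrite /sympart !trmx_mul sP -scalemxAr -scalemxAl mulmxDr mulmxDl.
by rewrite !mulmxA.
Qed.

Lemma mdot_delta X i j : mdot (delta_mx i j) X = X i j.
Proof.
by rewrite -(mul_delta_mx (0 : 'I_1)) -[delta_mx 0 j]trmx_delta mdotC mdot_outer bform_delta.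
Qed.

(* [1 - P] compresses to the kernel of [Y], where [W] agrees with the psd [X];
   the remaining blocks of [W] are absorbed by a multiple of [Y] of order
   [1 / eta], using the slack [eta / 2] on the kernel. *)
Lemma psd_shift P X Y W (c M eta : R) :
  symm_mx P -> P *m P = P -> 0 < c ->
  (forall x, c * bform P x x <= bform Y x x) -> symm_mx Y ->
  psd X -> symm_mx W -> (forall i j, `|W i j| <= M) ->
  (1%:M - P) *m W *m (1%:M - P) = (1%:M - P) *m X *m (1%:M - P) ->
  0 < eta <= 1 ->
  psd (W + (eta / 2)%:M +
       ((n%:R * (2 * (n%:R + 1) * M ^+ 2) + n%:R * (1 + M ^+ 2)) / c / eta) *: Y).
Proof.
move=> sP PP c0 cP sY pX sW WM WX /andP[eta0 eta1].
set S := _ / c; pose Q := 1%:M - P.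
have sQ : symm_mx Q by apply/symm_mxD/symm_mxN => //; exact: symm_scalar_mx.
have QQ : Q *m Q = Q by rewrite mulmxBr mulmx1 mulmxBl mul1mx PP subrr subr0.
split=> [|x].
  by apply: symm_mxD; [apply/symm_mxD/symm_scalar_mx|exact: symm_mxZ].
rewrite -/(bform _ _ _) !bformDm bformZm -[(eta / 2)%:M]scalemx1 bformZm.
pose u := P *m x; pose v := Q *m x.
have xE : x = u + v by rewrite /u /v -mulmxDl subrKC mul1mx.
have uP : bform P x x = bform 1%:M u u by rewrite -bform_mul mulmx1 sP PP.
have vQ : bform Q x x = bform 1%:M v v by rewrite -bform_mul mulmx1 sQ QQ.
have x1 : bform 1%:M x x = bform 1%:M u u + bform 1%:M v v.
  by rewrite -uP -vQ -bformDm subrKC.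
have Wv : 0 <= bform W v v.
  have : bform (Q *m W *m Q) x x = bform (Q *m X *m Q) x x by rewrite WX.
  by rewrite -{1 3}sQ !bform_mul => ->; exact: pX.2.
have Wx : bform W x x = bform W v v + 2 * bform W u v + bform W u u.
  rewrite [in LHS]xE !(bformDl, bformDr) (bformC v u sW); ring.
(* With this weight [n%:R * mu <= eta / 2], so the slack on the kernel pays for the cross term. *)
pose mu := eta / (2 * (n%:R + 1)).
have n0 : 0 <= n%:R :> R by [].
have n1 : 0 < n%:R + 1 :> R by rewrite ltr_wpDl.
have mu0 : 0 < mu by rewrite divr_gt0 // mulr_gt0.
have := bform_lower u v WM mu0.
have := bform_lower u u WM ltr01; rewrite invr1 mulr1 mul1r.
have := cP x; rewrite uP Wx x1.
have := bform1_ge0 u; have := bform1_ge0 v.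
set U := bform 1%:M u u; set V := bform 1%:M v v; set q := bform Y x x.
move: Wv; set wv := bform W v v; set wuv := bform W u v; set wu := bform W u u.
move=> wv0 V0 U0 cU hu huv.
have nmu : n%:R * mu * V <= eta / 2 * V.
  rewrite ler_wpM2r // /mu.
  have -> : n%:R * (eta / (2 * (n%:R + 1))) = eta / 2 * (n%:R / (n%:R + 1)).
    by field; rewrite gt_eqF.
  by rewrite ler_piMr // ?divr_ge0 ?(ltW eta0) // ler_pdivrMr // mul1r lerDl.
have M2mu : M ^+ 2 / mu = 2 * (n%:R + 1) * M ^+ 2 / eta.
  by rewrite /mu; field; rewrite !gt_eqF.
pose a1 : R := n%:R * (2 * (n%:R + 1) * M ^+ 2); pose a2 : R := n%:R * (1 + M ^+ 2).
have a10 : 0 <= a1.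
  apply: mulr_ge0 => //; apply: mulr_ge0; last exact: sqr_ge0.
  by apply: mulr_ge0 => //; exact: ltW.
have a20 : 0 <= a2.
  by apply: mulr_ge0 => //; apply: addr_ge0 => //; exact: sqr_ge0.
have {}huv : - (n%:R * mu * V + a1 / eta * U) <= 2 * wuv.
  by apply: le_trans huv; rewrite M2mu /a1 lerN2 le_eqVlt; apply/orP; left; apply/eqP; ring.
have {}hu : - (a2 * U) <= 2 * wu.
  by apply: le_trans hu; rewrite /a2 lerN2 le_eqVlt; apply/orP; left; apply/eqP; ring.
have Sq : a1 / eta * U + a2 / eta * U <= S / eta * q.
  have -> : a1 / eta * U + a2 / eta * U = S / eta * (c * U).
    by rewrite /S -/a1 -/a2; field; rewrite !gt_eqF.
  by rewrite ler_wpM2l // !divr_ge0 ?addr_ge0 // ltW.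
have a2U : a2 * U <= a2 / eta * U.
  by rewrite ler_wpM2r // ler_pdivlMr // ler_piMr.
have a2U0 : 0 <= a2 * U by rewrite mulr_ge0.
have eU : 0 <= eta / 2 * U by rewrite mulr_ge0 // divr_ge0 // ltW.
move: huv hu Sq a2U a2U0 eU nmu wv0; rewrite mulrDr.
move: (n%:R * mu * V) (a1 / eta * U) (a2 / eta * U) (a2 * U) (S / eta * q)
  (eta / 2 * U) (eta / 2 * V) => t1 t2 t3 t4 t5 t6 t7; lra.
Qed.

Lemma vreg0E (m : nat) (C : 'M[R]_n) (A : 'I_m -> 'M[R]_n) b (eta : R) :
  vreg C A b 0 eta = vP C A (fun i => b i + eta * mdot (A i) 1%:M).
Proof. by rewrite /vreg -[0%:M]scalemx1 scale0r addr0. Qed.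

Lemma reg_primal_feasible (m : nat) (A : 'I_m -> 'M[R]_n) b (eta : R) : 0 <= eta ->
  primal_feasible A b -> primal_feasible A (fun i => b i + eta * mdot (A i) 1%:M).
Proof.
move=> eta0 [X [pX AX]]; exists (X + eta%:M); split; first exact/psdD/psd_scalar.
by move=> i; rewrite mdotDr AX -[eta%:M]scalemx1 mdotZr.
Qed.

Lemma dual_slack_reg (m : nat) (C : 'M[R]_n) (A : 'I_m -> 'M[R]_n) eps y :
  dual_slack (C + eps%:M) A y = dual_slack C A y + eps%:M.
Proof. by rewrite /dual_slack addrAC. Qed.

Lemma reg_dual_feasible (m : nat) (C : 'M[R]_n) (A : 'I_m -> 'M[R]_n) eps : 0 <= eps ->
  dual_feasible C A -> dual_feasible (C + eps%:M) A.
Proof.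
by move=> eps0 [y py]; exists y; rewrite dual_slack_reg; exact/psdD/psd_scalar.
Qed.

(** Both [Z] and [Q] lie in the face, so the line through [Z] in direction [Q] stays in its affine
    hull. *)
Lemma rel_interior_face (Y Z Q : 'M[R]_n) :
  rel_interior (psd_face Y) Z -> psd Q -> mdot Q Y = 0 ->
  exists2 g : R, 0 < g & psd (Z - g *: Q).
Proof.
move=> [[pZ ZY] [e [e0 he]]] pQ QY.
pose D := mdot Q Q; have D0 : 0 <= D by exact: mdot_ge0.
pose g := e / (1 + D); have g0 : 0 < g by rewrite divr_gt0 // ltr_wpDr.
have eE : e = g * (1 + D) by rewrite divfK // gt_eqF // ltr_wpDr.
exists g => //; apply: (he _ _ _).1.
  (* The weight [g] on [0] brings the sum of the coefficients to one. *)
  exists 3%N, (fun i => nth 0 [:: 1; - g; g] i), (fun i => nth 0 [:: Z; Q; 0] i); split.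
    by case=> -[|[|[|//]]] /= _; split=> //; [exact: psd0|rewrite mdot0l].
  rewrite !big_ord_recl !big_ord0 /=; split; first by rewrite addr0 addNr addr0.
  by rewrite scale1r scaler0 !addr0 scaleNr.
rewrite addrAC subrr add0r mdotNl mdotNr opprK mdotZl mdotZr -/D eE; nra.
Qed.

(** Adding a multiple of [Y] changes neither the objective nor the constraints, only the trace. A
    trace of order [1 / eta] contributes the term [K * (eps / eta)]. *)
Lemma singularity_one_bound (m : nat) (C : 'M[R]_n) (A : 'I_m -> 'M[R]_n) b :
  symm_mx C -> (forall i, symm_mx (A i)) -> primal_feasible A b -> D_sing_deg_one C A ->
  exists2 K : R, 0 <= K & forall eps eta, 0 <= eps -> 0 < eta <= 1 ->
    vreg C A b eps eta <= vreg C A b 0 (eta / 2) + K * eta + K * (eps / eta).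
Proof.
move=> sC sA fP [fD [Y [_ [pY [CY [AY [y0 ri]]]]]]].
have sY : symm_mx Y by case: pY.
have [P [c [sP PP YP c0 cP]]] := psd_range_proj pY.
pose Q := 1%:M - P.
have sQ : symm_mx Q by apply/symm_mxD/symm_mxN => //; exact: symm_scalar_mx.
have QQ : Q *m Q = Q by rewrite mulmxBr mulmx1 mulmxBl mul1mx PP subrr subr0.
have pQ : psd Q by exact: psd_proj.
have QY : mdot Q Y = 0.
  by rewrite mdotC /mdot sY mulmxBr mulmx1 YP subrr mxtrace0.
(* [Q] projects onto the kernel of [Y]; the slack at [y0] dominates [g *: Q], which later bounds the
   kernel block of [X]. *)
have [g g0 pZQ] := rel_interior_face ri pQ QY.
have pZ : psd (dual_slack C A y0) by case: ri => -[].
have [X1 [pX1 AX1]] := fP.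
(* The data that [W] must share with [X]: objective, constraints and kernel block. *)
pose F (k : (option 'I_m + 'I_n * 'I_n)%type) : 'M[R]_n := match k with
  | inl None => C | inl (Some i) => A i | inr ij => Q *m delta_mx ij.1 ij.2 *m Q end.
have [K [K0 HK]] := bounded_preimage F.
pose a i : R := `|b i| + `|mdot (A i) 1%:M|.
have a0 i : 0 <= a i by rewrite addr_ge0.
(* Bounds the objective at [X] and the pairing of [X] with the slack at [y0], uniformly in
   [eta <= 1]. *)
pose M1 : R := `|mdot C X1| + `|mdot C 1%:M| + 1 + \sum_i a i * `|y0 i|.
have M10 : 0 <= M1.
  by rewrite /M1 !addr_ge0 //; apply: sumr_ge0 => i _; rewrite mulr_ge0.
pose B : R := M1 + M1 / g + \sum_i a i.
have sa0 : 0 <= \sum_i a i by apply: sumr_ge0.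
have M1g : 0 <= M1 / g by rewrite divr_ge0 // ltW.
have B0 : 0 <= B by do 2!apply: addr_ge0 => //.
pose M := K * B; have M0 : 0 <= M by rewrite mulr_ge0.
pose S := (n%:R * (2 * (n%:R + 1) * M ^+ 2) + n%:R * (1 + M ^+ 2)) / c.
have n0 : 0 <= n%:R :> R by [].
have S0 : 0 <= S.
  apply: divr_ge0; last exact: ltW.
  apply: addr_ge0; apply: mulr_ge0 => //; last by apply: addr_ge0 => //; exact: sqr_ge0.
  apply: mulr_ge0; last exact: sqr_ge0.
  by apply: mulr_ge0 => //; exact: addr_ge0.
have tY : 0 <= \tr Y by exact: psd_tr_ge0.
pose E := n%:R * M + n%:R + S * \tr Y.
have E0 : 0 <= E.
  by apply: addr_ge0; [apply: addr_ge0 => //|]; exact: mulr_ge0.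
exists (1 + `|mdot C 1%:M| + E).
  by apply: addr_ge0 => //; exact: addr_ge0.
move=> eps eta eps0 /[dup] eta01 /andP[eta0 eta1].
pose b2 i := b i + eta / 2 * mdot (A i) 1%:M.
have fP2 : primal_feasible A b2 by apply: reg_primal_feasible => //; rewrite divr_ge0 // ltW.
(* The tolerance [eta] is absorbed by the term [K * eta]. *)
have [X [pX AX CX]] := vP_approx fP2 fD eta0.
rewrite vreg0E -/b2; set v2 := vP C A b2 in CX *.
have b2a i : `|b2 i| <= a i.
  rewrite (le_trans (ler_normD _ _)) // lerD2l normrM ler_piMl //.
  by rewrite ger0_norm ?divr_ge0 // ?ltW // ltr_pdivrMr // mul1r; lra.
have CXu : mdot C X <= `|mdot C X1| + `|mdot C 1%:M| + 1.
  have v2u : v2 <= mdot C (X1 + (eta / 2)%:M).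
    apply: vP_le => //; first by apply/psdD/psd_scalar; rewrite // divr_ge0 // ltW.
    by move=> i; rewrite mdotDr AX1 -[(eta / 2)%:M]scalemx1 mdotZr.
  move: v2u; rewrite mdotDr -[(eta / 2)%:M]scalemx1 mdotZr => v2u.
  have : eta / 2 * mdot C 1%:M <= `|mdot C 1%:M|.
    apply: le_trans (ler_norm _) _; rewrite normrM ler_piMl //.
    by rewrite ger0_norm ?divr_ge0 // ?ltW // ltr_pdivrMr // mul1r; lra.
  have := ler_norm (mdot C X1); lra.
have by0 : `|\sum_i b2 i * y0 i| <= \sum_i a i * `|y0 i|.
  rewrite (le_trans (ler_norm_sum _ _ _)) //; apply: ler_sum => i _.
  by rewrite normrM ler_wpM2r.
have ZX : mdot (dual_slack C A y0) X = mdot C X - \sum_i b2 i * y0 i.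
  exact: mdot_dual_slack.
have ZX0 : 0 <= mdot (dual_slack C A y0) X by exact: mdot_psd.
have ZXM : mdot (dual_slack C A y0) X <= M1.
  by move: by0; rewrite ZX /M1 ler_norml => /andP[]; lra.
have CXM : `|mdot C X| <= M1.
  rewrite ler_norml; move: by0; rewrite ler_norml => /andP[h1 h2].
  move: CXu ZX0 h1 h2 (normr_ge0 (mdot C X1)) (normr_ge0 (mdot C 1%:M)).
  rewrite ZX /M1; move: (mdot C X) `|_| `|_| (\sum_i b2 i * _) (\sum_i a i * _).
  by clear; move=> *; apply/andP; split; lra.
have QXM : mdot Q X <= M1 / g.
  rewrite ler_pdivlMr // mulrC; apply: le_trans ZXM.
  by have := mdot_psd pZQ pX; rewrite mdotBl mdotZl subr_ge0.
have pQX : psd (Q *m X *m Q).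
  split=> [|x]; first by rewrite /symm_mx !trmx_mul sQ pX.1 mulmxA.
  by rewrite -/(bform _ _ _) -{1}sQ bform_mul; exact: pX.2.
have trQ : \tr (Q *m X *m Q) = mdot Q X.
  by rewrite /mdot mxtrace_mulC mulmxA QQ sQ.
have XB k : `|mdot (F k) X| <= B.
  case: k => [[i|]|[i j]] /=.
  - rewrite AX (le_trans (b2a i)) // (le_trans (_ : _ <= \sum_i a i)) //.
      by rewrite (bigD1 i) //= lerDl; apply: sumr_ge0.
    by rewrite /B lerDr addr_ge0.
  - by rewrite (le_trans CXM) // /B -addrA lerDl addr_ge0.
  - rewrite mdot_conj // mdot_delta (le_trans (psd_entry_le _ _ pQX)) // trQ.
    rewrite (le_trans QXM) // /B addrAC lerDr addr_ge0 //.
have [W0 [FW WM0]] := HK X B B0 XB.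
pose W := sympart W0; have sW : symm_mx W by exact: symm_sympart.
have WM i j : `|W i j| <= M.
  rewrite /W /sympart !mxE normrM ger0_norm ?invr_ge0 //.
  have := ler_normD (W0 i j) (W0 j i); have := WM0 i j; have := WM0 j i.
  by rewrite -/M; lra.
have AW i : mdot (A i) W = b2 i.
  by rewrite mdotC mdot_sympart // mdotC (FW (inl (Some i))) /= AX.
have CW : mdot C W = mdot C X by rewrite mdotC mdot_sympart // mdotC (FW (inl None)).
have QW : Q *m W *m Q = Q *m X *m Q.
  have QW0 : Q *m W0 *m Q = Q *m X *m Q.
    apply/matrixP => i j; have := FW (inr (i, j)).
    by rewrite /= !mdot_conj // !mdot_delta.
  by rewrite sympart_conj // QW0 sympart_id //; exact: pQX.1.
have pX2 := psd_shift sP PP c0 cP sY pX sW WM QW eta01.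
rewrite -/S in pX2; set X2 := W + _ + _ in pX2.
have half : eta / 2 + eta / 2 = eta by lra.
(* [X] solves the problem for [eta / 2], and the multiple of the identity in [X2] supplies the other
   half. *)
have AX2 i : mdot (A i) X2 = b i + eta * mdot (A i) 1%:M.
  rewrite !mdotDr mdotZr AY mulr0 addr0 AW -[(eta / 2)%:M]scalemx1 mdotZr /b2.
  by rewrite -addrA -mulrDl half.
have le_eta z : 0 <= z -> z <= z / eta.
  by move=> z0; rewrite ler_pdivlMr // ler_piMr.
have trX2 : mdot X2 1%:M <= E / eta.
  rewrite mdot1r 2!mxtraceD [\tr (_ *: Y)]mxtraceZ mxtrace_scalar.
  have trW : \tr W <= n%:R * M.
    rewrite mulr_natl -[X in _ *+ X]card_ord -sumr_const; apply: ler_sum => i _.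
    exact: le_trans (ler_norm _) (WM i i).
  rewrite /E mulrDl [(_ + n%:R) / _]mulrDl; apply: lerD; first apply: lerD.
  - by apply: (le_trans trW); apply: le_eta; exact: mulr_ge0.
  - rewrite -[_ / 2 *+ n]mulr_natl; apply: (le_trans _ (le_eta _ n0)); apply: ler_piMr => //.
    by move: eta1; clear; lra.
  - by rewrite mulrAC.
have CX2 : mdot C X2 = mdot C X + eta / 2 * mdot C 1%:M.
  by rewrite !mdotDr mdotZr CY mulr0 addr0 CW -[(eta / 2)%:M]scalemx1 mdotZr.
have v_le : vreg C A b eps eta <= mdot C X2 + eps * mdot X2 1%:M.
  have -> : mdot C X2 + eps * mdot X2 1%:M = mdot (C + eps%:M) X2.
    by rewrite mdotDl -[eps%:M]scalemx1 [mdot (_ *: _) _]mdotZl (mdotC 1%:M).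
  by apply: vP_le => //; exact: reg_dual_feasible.
have h1 : eta / 2 * mdot C 1%:M <= `|mdot C 1%:M| * eta.
  move: (ler_norm (mdot C 1%:M)) (normr_ge0 (mdot C 1%:M)) eta0.
  by move: (mdot C _) `|_|; clear; move=> w z *; nra.
have h2 : eps * mdot X2 1%:M <= E * (eps / eta).
  by rewrite mulrCA ler_wpM2l.
have h3 : 0 <= E * eta by apply: mulr_ge0 => //; exact: ltW.
have h4 : 0 <= (1 + `|mdot C 1%:M|) * (eps / eta).
  by apply: mulr_ge0; [exact: addr_ge0|apply: divr_ge0 => //; exact: ltW].
apply: (le_trans v_le); rewrite CX2; move: CX h1 h2 h3 h4.
move: (v2) (mdot C 1%:M) (mdot C X) (eps / eta) (E) `|mdot C 1%:M| (mdot X2 1%:M).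
by clear; move=> *; lra.
Qed.
End ErrorBound.

(** * Limits at zero from the right *)

Section RightLimits.
Context {R : realType}.
Implicit Types (f g : R -> R).

Lemma near_right0 (P : R -> Prop) : (\forall t \near 0^'+, P t) -> right0 P.
Proof.
rewrite /at_right /prop_near1 /within /= => /nbhs_ballP[d /= d0 Pd].
exists d => // t /andP[t0 td]; apply: Pd => //.
by rewrite /ball /= sub0r normrN gtr0_norm.
Qed.

Lemma right0_ex (P : R -> Prop) : right0 P -> exists2 t, 0 < t & P t.
Proof.
by move=> [d d0 Pd]; exists (d / 2); [|apply: Pd; apply/andP; split]; lra.
Qed.

Lemma right0_scale (P : R -> Prop) (s : R) : 0 < s -> right0 P -> right0 (fun t => P (t * s)).
Proof.
move=> s0 [d d0 Pd]; exists (d / s); first exact: divr_gt0.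
by move=> t; rewrite ltr_pdivlMr // => /andP[t0 td]; apply: Pd; rewrite mulr_gt0.
Qed.

Lemma right0_lt (d : R) : 0 < d -> right0 (fun t => t < d).
Proof. by move=> d0; exists d => // t /andP[]. Qed.

Lemma right0_small (K e : R) : 0 < e -> right0 (fun t => `|K * t| < e).
Proof.
move=> e0; have K0 : 0 < `|K| + 1 by rewrite ltr_wpDl.
exists (e / (`|K| + 1)) => [|t /andP[t0]]; first exact: divr_gt0.
rewrite ltr_pdivlMr // normrM (gtr0_norm t0) => h.
by have := normr_ge0 K; nra.
Qed.

Lemma cvg_right0P f (l : R) : f t @[t --> 0^'+] --> (l : R^o) <->
  forall e, 0 < e -> right0 (fun t => `|l - f t| < e).
Proof.
split=> [/cvgrPdist_lt h e /h/near_right0 //|h].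
by apply/cvgrPdist_lt => e /h/right0_near.
Qed.

Lemma le_cvg_right0 f g (lf lg K c : R) :
  f t @[t --> 0^'+] --> (lf : R^o) -> g t @[t --> 0^'+] --> (lg : R^o) ->
  right0 (fun t => f t <= g t + K * t + c) -> lf <= lg + c.
Proof.
move=> /cvg_right0P cf /cvg_right0P cg fg; rewrite leNgt; apply/negP => lt_l.
(* Three errors, for [f], [g] and [K * t], each stay below a quarter of the gap. *)
pose e := (lf - lg - c) / 4; have e0 : 0 < e by rewrite /e; lra.
have [t _ [[[]]]] := right0_ex (right0I (right0I (right0I fg (cf _ e0)) (cg _ e0))
  (right0_small K e0)).
rewrite !ltr_norml /e => h1 /andP[h2 h3] /andP[h4 h5] /andP[h6 h7].
by move: h1 h2 h3 h4 h5 h6 h7; move: (K * t) (f t) (g t); clear; move=> *; lra.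
Qed.
End RightLimits.

(** * The regularized value and its limits along rays *)

Section LimitValue.
Context {R : realType} {n m : nat}.
Variables (C : 'M[R]_n) (A : 'I_m -> 'M[R]_n) (b : 'I_m -> R).
Hypotheses (fP : primal_feasible A b) (fD : dual_feasible C A).
Local Notation vreg := (vreg C A b).

Lemma mdot_reg (D X : 'M[R]_n) (e : R) : mdot (D + e%:M) X = mdot D X + e * \tr X.
Proof. by rewrite mdotDl -[e%:M]scalemx1 mdotZl (mdotC 1%:M) mdot1r. Qed.

Lemma vreg_le (e h : R) X : 0 <= e -> psd X ->
  (forall i, mdot (A i) X = b i + h * mdot (A i) 1%:M) ->
  vreg e h <= mdot C X + e * \tr X.
Proof.
by move=> e0 pX AX; rewrite -mdot_reg; apply: vP_le => //; exact: reg_dual_feasible.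
Qed.

Lemma vreg_ge (e h r : R) : 0 <= h ->
  (forall X, psd X -> (forall i, mdot (A i) X = b i + h * mdot (A i) 1%:M) ->
     r <= mdot C X + e * \tr X) -> r <= vreg e h.
Proof.
move=> h0 H; apply: vP_ge; first exact: reg_primal_feasible.
by move=> X pX AX; rewrite mdot_reg; exact: H.
Qed.

Lemma vreg_approx (e h d : R) : 0 <= e -> 0 <= h -> 0 < d ->
  exists X, [/\ psd X, forall i, mdot (A i) X = b i + h * mdot (A i) 1%:M &
    mdot C X + e * \tr X < vreg e h + d].
Proof.
move=> e0 h0 d0.
have [X []] := vP_approx (reg_primal_feasible h0 fP) (reg_dual_feasible e0 fD) d0.
by rewrite mdot_reg; exists X.
Qed.

(** The feasible set depends on [h] only, and [e] multiplies a nonnegative trace. *)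
Lemma vreg_mono (e e' h : R) : 0 <= e -> e <= e' -> 0 <= h -> vreg e h <= vreg e' h.
Proof.
move=> e0 ee' h0; apply: vreg_ge => // X pX AX.
apply: le_trans (vreg_le e0 pX AX) _.
by rewrite lerD2l ler_wpM2r // psd_tr_ge0.
Qed.

(** For fixed [h] the value is an infimum of functions affine in [e]. *)
Lemma vreg_concave (a e e' h : R) : 0 <= a <= 1 -> 0 <= e -> 0 <= e' -> 0 <= h ->
  a * vreg e h + (1 - a) * vreg e' h <= vreg (a * e + (1 - a) * e') h.
Proof.
move=> /andP[a0 a1] e0 e'0 h0; apply: vreg_ge => // X pX AX.
have := vreg_le e0 pX AX; have := vreg_le e'0 pX AX.
move: (vreg e h) (vreg e' h) (mdot C X) (\tr X); move: a0 a1; clear; move=> *; nra.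
Qed.

Lemma vreg_cvg (al be : R) : 0 <= al -> 0 <= be ->
  exists l : R, vreg (t * al) (t * be) @[t --> 0^'+] --> (l : R^o).
Proof.
move=> al0 be0; have [X [pX AX]] := fP; have [y py] := fD.
pose phi (t : R) : R := vreg (t * al) (t * be).
(* For [t < 1], weak duality at [y] bounds the value below and the shifted point [X + (t * be)%:M]
   bounds it above. *)
pose M : R := `|mdot C X| + `|be * mdot C 1%:M| + `|al * \tr X| + `|al * (be * n%:R)|
  + `|\sum_i b i * y i| + `|be * \sum_i mdot (A i) 1%:M * y i|.
apply: (@cvg_right0 _ phi M) => [|c].
  exists 1 => // t /andP[t0 t1].
  have te : 0 <= t * al by rewrite mulr_ge0 // ltW.
  have th : 0 <= t * be by rewrite mulr_ge0 // ltW.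
  have tn (z : R) : `|t * z| <= `|z| by rewrite normrM ler_piMl // gtr0_norm // ltW.
  apply/andP; split.
    apply: vreg_ge => // Y pY AY.
    have pS : psd (dual_slack (C + (t * al)%:M) A y).
      by rewrite dual_slack_reg; apply/psdD/psd_scalar.
    have := weak_duality pY AY pS; rewrite mdot_reg; apply: le_trans.
    under eq_bigr do rewrite mulrDl; rewrite big_split /=.
    have -> : \sum_i t * be * mdot (A i) 1%:M * y i =
        t * (be * \sum_i mdot (A i) 1%:M * y i).
      by rewrite !mulr_sumr; apply: eq_bigr => i _; ring.
    have := tn (be * \sum_i mdot (A i) 1%:M * y i).
    rewrite /M; have := ler_norm (- \sum_i b i * y i); rewrite normrN.
    rewrite ler_norml => h1 /andP[h2 h3].
    have := normr_ge0 (mdot C X); have := normr_ge0 (be * mdot C 1%:M).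
    have := normr_ge0 (al * \tr X); have := normr_ge0 (al * (be * n%:R)); lra.
  have pX' : psd (X + (t * be)%:M) by apply/psdD/psd_scalar.
  have AX' i : mdot (A i) (X + (t * be)%:M) = b i + t * be * mdot (A i) 1%:M.
    by rewrite mdotDr AX -scalemx1 mdotZr.
  have := vreg_le te pX' AX'; rewrite -/(phi t) mdotDr -scalemx1 mdotZr.
  rewrite mxtraceD mxtraceZ mxtrace1 => /le_trans; apply.
  have tl z : t * z <= `|z| by exact: le_trans (ler_norm _) (tn z).
  have h1 := tl (be * mdot C 1%:M); have h2 := tl (al * \tr X).
  have h3 : t * al * (t * be * n%:R) <= `|al * (be * n%:R)|.
    rewrite (_ : _ * _ = t * (t * (al * (be * n%:R)))); last by ring.
    exact: le_trans (tl _) (tn _).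
  have h4 := ler_norm (mdot C X); have h5 := normr_ge0 (\sum_i b i * y i).
  have h6 := normr_ge0 (be * \sum_i mdot (A i) 1%:M * y i).
  by rewrite /M mulrDr -[t * be * _]mulrA -[t * al * \tr X]mulrA; lra.
have [f fE] := feasible_value_definable C A b al be c.
have fE' t : 0 < t -> ordered_qelim.ord.holds [:: t] f <-> phi t < c.
  move=> t0; rewrite fE; split=> [[Y [pY AY Yc]]|lt_c].
    apply: le_lt_trans Yc; rewrite mdot_reg; apply: vreg_le => //.
    by rewrite mulr_ge0 // ltW.
  have cp : 0 < c - phi t by rewrite subr_gt0.
  have [Y [pY AY Yc]] := vreg_approx (mulr_ge0 (ltW t0) al0) (mulr_ge0 (ltW t0) be0) cp.
  by exists Y; split=> //; rewrite mdot_reg; move: Yc; rewrite -/(phi t) subrKC.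
by have [h|h] := holds_right0 f; [left|right]; apply: right0S h => t t0; rewrite fE'.
Qed.

(** The limit along an arbitrary ray; homogeneity ([wlim_scale]) then allows one coordinate to be
    normalized. *)
Definition wlim (al be : R) : R :=
  lim (vreg (t * al) (t * be) @[t --> (0:R)^'+] : set_system R^o).

Lemma vaE x : va C A b x = wlim (cos x) (sin x).
Proof. by []. Qed.

Lemma wlim_cvg al be : 0 <= al -> 0 <= be ->
  vreg (t * al) (t * be) @[t --> 0^'+] --> (wlim al be : R^o).
Proof.
by move=> al0 be0; have [l hl] := vreg_cvg al0 be0; rewrite /wlim (cvg_lim _ hl).
Qed.

Lemma wlim_eq al be (l : R) :
  vreg (t * al) (t * be) @[t --> 0^'+] --> (l : R^o) -> wlim al be = l.
Proof. by move=> h; rewrite /wlim (cvg_lim _ h). Qed.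

Lemma wlim_scale s al be : 0 < s -> 0 <= al -> 0 <= be ->
  wlim (s * al) (s * be) = wlim al be.
Proof.
move=> s0 al0 be0; apply: wlim_eq; apply/cvg_right0P => e e0.
have /cvg_right0P/(_ _ e0)/(right0_scale s0) := wlim_cvg al0 be0.
by apply: right0S => t _; rewrite !mulrA.
Qed.

Lemma wlim_mono al al' be : 0 <= al -> al <= al' -> 0 <= be -> wlim al be <= wlim al' be.
Proof.
move=> al0 aa' be0; have al'0 := le_trans al0 aa'; rewrite -[leRHS]addr0.
apply: (le_cvg_right0 (K := 0) (wlim_cvg al0 be0) (wlim_cvg al'0 be0)).
apply: right0T => t /ltW t0; rewrite mul0r !addr0.
by apply: vreg_mono; rewrite ?mulr_ge0 // ler_wpM2l.
Qed.

Lemma wlim_concave a al al' be : 0 <= a <= 1 -> 0 <= al -> 0 <= al' -> 0 <= be ->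
  a * wlim al be + (1 - a) * wlim al' be <= wlim (a * al + (1 - a) * al') be.
Proof.
move=> /[dup] a01 /andP[a0 a1] al0 al'0 be0; rewrite -[leRHS]addr0.
have a'0 : 0 <= 1 - a by rewrite subr_ge0.
have l0 : 0 <= a * al + (1 - a) * al' by rewrite addr_ge0 ?mulr_ge0.
apply: (le_cvg_right0 (K := 0) _ (wlim_cvg l0 be0)).
  by apply: cvgD; apply: cvgMr; exact: wlim_cvg.
apply: right0T => t /ltW t0; rewrite mul0r !addr0.
rewrite [t * (_ + _)](_ : _ = a * (t * al) + (1 - a) * (t * al')); last by ring.
by apply: vreg_concave; rewrite ?mulr_ge0.
Qed.

(** On this ray the constraints are unperturbed, and [t * \tr X] vanishes for a fixed nearly optimal
    [X]. *)
Lemma wlim10 : wlim 1 0 = vP C A b.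
Proof.
have feasE X : (forall i, mdot (A i) X = b i + 0 * mdot (A i) 1%:M) <->
    forall i, mdot (A i) X = b i.
  by split=> h i; rewrite h mul0r addr0.
apply: wlim_eq; apply/cvg_right0P => e e0.
have e20 : 0 < e / 2 by rewrite divr_gt0.
have [X [pX AX CX]] := vP_approx fP fD e20.
apply: right0S (right0_small (\tr X) e20) => t t0 ht; rewrite mulr1 mulr0.
have h1 : vP C A b <= vreg t 0.
  apply: vreg_ge => // Y pY /feasE AY; apply: le_trans (vP_le fD pY AY) _.
  by rewrite lerDl mulr_ge0 ?psd_tr_ge0 // ltW.
have h2 : vreg t 0 <= mdot C X + t * \tr X.
  by apply: vreg_le => //; [exact: ltW|apply/feasE].
move: ht; rewrite !ltr_norml => /andP[_ ht]; apply/andP; split; lra.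
Qed.

Lemma wlim_sing_bound : symm_mx C -> (forall i, symm_mx (A i)) -> D_sing_deg_one C A ->
  exists2 K : R, 0 <= K & forall al be, 0 <= al -> 0 < be ->
    wlim al be <= wlim 0 1 + K * (al / be).
Proof.
move=> sC sA sing; have [K K0 HK] := singularity_one_bound sC sA fP sing.
exists K => // al be al0 be0.
(* Homogeneity matches the halved perturbation in [singularity_one_bound]. *)
have -> : wlim 0 1 = wlim 0 (be / 2).
  have := @wlim_scale (be / 2) 0 1; rewrite mulr0 mulr1 => -> //.
  by rewrite divr_gt0.
have be20 : 0 <= be / 2 by rewrite divr_ge0 // ltW.
apply: (le_cvg_right0 (K := K * be) (wlim_cvg al0 (ltW be0)) (wlim_cvg (lexx _) be20)).
apply: right0S (right0_lt (divr_gt0 ltr01 be0)) => t t0.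
rewrite ltr_pdivlMr // => tb.
have := HK (t * al) (t * be); rewrite mulr_ge0 ?(ltW t0) // mulr_gt0 // (ltW tb).
move=> /(_ isT isT); rewrite mulr0 -[t * be / 2]mulrA.
have -> : t * al / (t * be) = al / be by rewrite -mulf_div divff ?gt_eqF // mul1r.
by have -> : K * (t * be) = K * be * t by ring.
Qed.
End LimitValue.

(** * Orthogonal complements in the symmetric matrices *)

Section DualPair.
Context {R : realType} {n : nat}.
Implicit Types (X Y Z : 'M[R]_n).

(** The spans are orthogonal complements of each other; stating both inclusions makes the relation
    symmetric. *)
Definition dual_pair (m k : nat) (A : 'I_m -> 'M[R]_n) (G : 'I_k -> 'M[R]_n) :=
  [/\ forall i, symm_mx (A i), forall j, symm_mx (G j),
      forall i j, mdot (A i) (G j) = 0,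
      forall Y, symm_mx Y -> (forall j, mdot (G j) Y = 0) ->
        exists y : 'I_m -> R, Y = \sum_i y i *: A i &
      forall X, symm_mx X -> (forall i, mdot (A i) X = 0) ->
        exists z : 'I_k -> R, X = \sum_j z j *: G j].

Lemma dual_pair_sym (m k : nat) (A : 'I_m -> 'M[R]_n) (G : 'I_k -> 'M[R]_n) :
  dual_pair A G -> dual_pair G A.
Proof. by case=> sA sG AG h1 h2; split=> // j i; rewrite mdotC. Qed.

Lemma sympart_sum (k : nat) (z : 'I_k -> R) (V : 'I_k -> 'M[R]_n) :
  sympart (\sum_j z j *: V j) = \sum_j z j *: sympart (V j).
Proof.
rewrite /sympart linear_sum -big_split scaler_sumr /=; apply: eq_bigr => j _.
by rewrite linearZ /= -scalerDr !scalerA mulrC.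
Qed.

(** [G] consists of the symmetrized rows of a kernel matrix; [kermx] is square, hence the [n * n]
    members. *)
Lemma dual_pair_exists (m : nat) (A : 'I_m -> 'M[R]_n) :
  (forall i, symm_mx (A i)) -> exists G : 'I_(n * n) -> 'M[R]_n, dual_pair A G.
Proof.
move=> sA; pose L : 'M[R]_(n * n, m) := \matrix_(p, i) mxvec (A i) 0 p.
have LE (u : 'rV[R]_(n * n)) i : (u *m L) 0 i = mdot (A i) (vec_mx u).
  rewrite mxE mdotC mdot_mxvec vec_mxK; apply: eq_bigr => p _.
  by rewrite mxE.
pose K := kermx L; pose G j := sympart (vec_mx (row j K)).
exists G; split=> //.
- by move=> j; exact: symm_sympart.
- by move=> i j; rewrite mdotC mdot_sympart // mdotC -LE -row_mul mulmx_ker row0 mxE.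
- move=> Y sY GY.
  have KY : mxvec Y *m K^T = 0.
    apply/rowP => j; rewrite [RHS]mxE -(GY j) mdot_sympart // mdotC mdot_mxvec vec_mxK mxE.
    by apply: eq_bigr => p _; rewrite !mxE.
  have LK : (L^T <= kermx K^T)%MS.
    by apply/sub_kermxP; rewrite -trmx_mul mulmx_ker trmx0.
  (* The double orthogonal complement adds nothing: the ranks agree. *)
  have KL : (kermx K^T <= L^T)%MS.
    rewrite -(mxrank_leqif_sup LK) mxrank_ker !mxrank_tr mxrank_ker subKn //.
    exact: rank_leq_row.
  have /submxP[D DE] : (mxvec Y <= L^T)%MS.
    by apply: submx_trans KL; exact/sub_kermxP.
  exists (fun i => D 0 i); apply: (can_inj mxvecK).
  rewrite DE mulmx_sum_row linear_sum; apply: eq_bigr => i _.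
  by rewrite linearZ /=; congr (_ *: _); apply/rowP => p; rewrite !mxE.
move=> X sX AX.
have /submxP[D DE] : (mxvec X <= K)%MS.
  by apply/sub_kermxP/rowP => i; rewrite LE mxvecK AX mxE.
exists (fun j => D 0 j); rewrite -sympart_sum -[LHS]sympart_id //; congr sympart.
rewrite -[LHS]mxvecK DE mulmx_sum_row linear_sum; apply: eq_bigr => j _.
by rewrite linearZ.
Qed.
End DualPair.

(** * Exchange of the primal and the dual problem *)

Section PairDuality.
Context {R : realType} {n m k : nat}.
Variables (C B : 'M[R]_n) (A : 'I_m -> 'M[R]_n) (G : 'I_k -> 'M[R]_n).
Hypotheses (sC : symm_mx C) (sB : symm_mx B) (AG : dual_pair A G).
Let b i := mdot (A i) B.
Let c j := mdot (G j) C.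

Lemma slack_mdot y j : mdot (G j) (dual_slack C A y) = c j.
Proof.
have [_ _ ortho _ _] := AG; rewrite mdotBr mdot_sumr big1 ?subr0 // => i _.
by rewrite mdotZr mdotC ortho mulr0.
Qed.

(** Converse of [slack_mdot]: together they identify the dual slacks with the symmetric solutions of
    the exchanged constraints. *)
Lemma mdot_slackP Z : symm_mx Z -> (forall j, mdot (G j) Z = c j) ->
  exists y, Z = dual_slack C A y.
Proof.
have [_ _ _ span _] := AG => sZ GZ; have [||y yE] := span (C - Z).
- exact/symm_mxD/symm_mxN.
- by move=> j; rewrite mdotBr GZ subrr.
by exists y; rewrite /dual_slack -yE opprB subrKC.
Qed.

Lemma mdot_slack_value y :
  mdot B (dual_slack C A y) = mdot C B - \sum_i b i * y i.
Proof. by rewrite mdotC; exact: mdot_dual_slack. Qed.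

Lemma pair_primal_feasible : dual_feasible C A -> primal_feasible G c.
Proof. by move=> [y py]; exists (dual_slack C A y); split=> // j; exact: slack_mdot. Qed.

(** The dual objective at [y] is [mdot C B] minus the exchanged objective at its slack, so
    maximizing one minimizes the other. *)
Lemma vD_pair : primal_feasible A b -> dual_feasible C A -> dual_feasible B G ->
  vD C A b = mdot C B - vP B G c.
Proof.
move=> [X [pX AX]] fD fD'; have fP' := pair_primal_feasible fD.
pose E := [set \sum_i b i * y i | y in [set y | psd (dual_slack C A y)]].
have ubE : has_ubound E.
  by exists (mdot C X) => _ [y py <-]; exact: weak_duality.
apply/eqP; rewrite eq_le; apply/andP; split.
  apply: sup_le_ub => [|_ [y py <-]].
    by case: fD => y py; exists (\sum_i b i * y i), y.
  have := vP_le fD' py (slack_mdot y); rewrite mdot_slack_value; lra.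
suff : mdot C B - vD C A b <= vP B G c by lra.
apply: vP_ge => // Z /[dup] pZ [sZ _] GZ; have [y yE] := mdot_slackP sZ GZ.
rewrite yE mdot_slack_value lerD2l lerN2; apply: ub_le_sup => //.
by exists y => //=; rewrite -yE.
Qed.

(** One inequality is strong duality, from the strictly feasible slack at [y1]; the other is the
    nonnegative pairing of feasible points. *)
Lemma pair_strong_duality y1 (e : R) : primal_feasible A b -> dual_feasible B G ->
  0 < e -> psd (dual_slack C A y1 - e%:M) -> vP C A b + vP B G c = mdot C B.
Proof.
move=> fP fD' e0 py1; have [sA _ _ _ _] := AG.
have fD : dual_feasible C A.
  by exists y1; rewrite -[X in psd X](subrK e%:M); apply/psdD/psd_scalar/ltW.
have fP' := pair_primal_feasible fD.
apply/eqP; rewrite eq_le; apply/andP; split.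
  apply/ler_addgt0Pr => d d0.
  have [y [py yd]] := strong_duality sC sA fP e0 py1 d0.
  have := vP_le fD' py (slack_mdot y); rewrite mdot_slack_value; lra.
rewrite -lerBlDr; apply: vP_ge => // X pX AX.
rewrite lerBlDr -lerBlDl; apply: vP_ge => // Z /[dup] pZ [sZ _] GZ.
have [y yE] := mdot_slackP sZ GZ.
rewrite yE mdot_slack_value in pZ *; have := mdot_psd pZ pX.
rewrite (mdot_dual_slack C y AX); lra.
Qed.
End PairDuality.

(** * Singularity certificates and regularization under the exchange *)

Section RegularizedDuality.
Context {R : realType} {n m k : nat}.
Variables (C B : 'M[R]_n) (A : 'I_m -> 'M[R]_n) (G : 'I_k -> 'M[R]_n).
Hypotheses (sC : symm_mx C) (sB : symm_mx B) (AG : dual_pair A G).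
Local Notation b := (fun i => mdot (A i) B).
Local Notation c := (fun j => mdot (G j) C).
Hypotheses (fP : primal_feasible A b) (fD : dual_feasible C A).

Lemma pair_dual_feasible : dual_feasible B G.
Proof.
have [X [/[dup] pX [sX _] AX]] := fP.
have [z zE] := mdot_slackP sB (dual_pair_sym AG) sX AX.
by exists z; rewrite -zE.
Qed.

(** The certificate is a combination of the [A i], hence orthogonal to every [G j], and [b^T y = 0]
    says that it is orthogonal to [B]. The point [X] becomes a slack. *)
Lemma P_sing_dual : P_sing_deg_one A b -> D_sing_deg_one B G.
Proof.
have [_ _ ortho _ _] := AG.
move=> [_ [y [S0 [pS [by0 [X [AX ri]]]]]]]; split; first exact: pair_dual_feasible.
exists (\sum_i y i *: A i); split=> //; split=> //; split; last split.
- rewrite mdot_sumr -[RHS]by0; apply: eq_bigr => i _.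
  by rewrite mdotZr mdotC mulrC.
- by move=> j; rewrite mdot_sumr big1 // => i _; rewrite mdotZr mdotC ortho mulr0.
have sX : symm_mx X by case: ri => -[[]].
have [z zE] := mdot_slackP sB (dual_pair_sym AG) sX AX.
by exists z; rewrite -zE.
Qed.
End RegularizedDuality.

Lemma mdot_addr (R : realType) (n m : nat) (A : 'I_m -> 'M[R]_n) (B : 'M[R]_n) (h : R) :
  (fun i => mdot (A i) (B + h%:M)) = (fun i => mdot (A i) B + h * mdot (A i) 1%:M).
Proof. by apply/funext => i; rewrite mdotDr -[h%:M]scalemx1 mdotZr. Qed.

(** Adding [e%:M] to [C] makes every feasible [y] strictly feasible, and the perturbation of the
    constraints amounts to replacing [B] by [B + h%:M]. *)
Lemma vreg_duality_gt0 (R : realType) (n m k : nat) (C B : 'M[R]_n) (A : 'I_m -> 'M[R]_n)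
    (G : 'I_k -> 'M[R]_n) (e h : R) :
  symm_mx C -> symm_mx B -> dual_pair A G ->
  primal_feasible A (fun i => mdot (A i) B) -> dual_feasible C A ->
  0 < e -> 0 <= h ->
  vreg C A (fun i => mdot (A i) B) e h + vreg B G (fun j => mdot (G j) C) h e =
  mdot (C + e%:M) (B + h%:M).
Proof.
move=> sC sB AG fP fD e0 h0; have [y py] := fD.
have fD' := pair_dual_feasible sB AG fP.
have := @pair_strong_duality _ _ _ _ (C + e%:M) (B + h%:M) A G _ AG y e.
rewrite !mdot_addr; apply=> //.
- exact/symm_mxD/symm_scalar_mx.
- exact: reg_primal_feasible.
- exact: reg_dual_feasible.
- by rewrite dual_slack_reg addrK.
Qed.

(** * Duality for the limiting values *)

Section LimitDuality.
Context {R : realType} {n m k : nat}.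
Variables (C B : 'M[R]_n) (A : 'I_m -> 'M[R]_n) (G : 'I_k -> 'M[R]_n).
Hypotheses (sC : symm_mx C) (sB : symm_mx B) (AG : dual_pair A G).
Local Notation b := (fun i => mdot (A i) B).
Local Notation c := (fun j => mdot (G j) C).
Hypotheses (fP : primal_feasible A b) (fD : dual_feasible C A).

Lemma vreg_duality (e h : R) : 0 <= e -> 0 <= h -> 0 < e + h ->
  vreg C A b e h + vreg B G c h e = mdot (C + e%:M) (B + h%:M).
Proof.
(* If [e = 0], then [h > 0] and the exchanged pair is the strictly feasible one. *)
rewrite le_eqVlt => /predU1P[<- _|e0 h0 _]; last exact: vreg_duality_gt0.
rewrite add0r => h0; rewrite addrC mdotC; apply: vreg_duality_gt0 => //.
- exact: dual_pair_sym.
- exact: (pair_primal_feasible AG fD).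
- exact: (pair_dual_feasible sB AG fP).
Qed.

Lemma wlim_duality (al be : R) : 0 <= al -> 0 <= be -> 0 < al + be ->
  wlim C A b al be = mdot C B - wlim B G c be al.
Proof.
move=> al0 be0 ab0; apply: wlim_eq; apply/cvg_right0P => e e0.
have fD' := pair_dual_feasible sB AG fP.
have fP' := pair_primal_feasible AG fD.
have e20 : 0 < e / 2 by rewrite divr_gt0.
have /cvg_right0P/(_ _ e20) hw := wlim_cvg fP' fD' be0 al0.
(* Coefficients of [t] and [t ^+ 2] in [mdot (C + (t * al)%:M) (B + (t * be)%:M)]. *)
pose k1 := be * \tr C + al * \tr B; pose k2 := al * (be * n%:R).
apply: right0S (right0I hw (right0I (right0_lt ltr01) (right0_small (`|k1| + `|k2|) e20))).
move=> t t0 [h1 [t1 h2]].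
have dE := vreg_duality (mulr_ge0 (ltW t0) al0) (mulr_ge0 (ltW t0) be0) (_ : 0 < _).
have {}dE : vreg C A b (t * al) (t * be) =
    mdot C B + t * (k1 + t * k2) - vreg B G c (t * be) (t * al).
  apply/eqP; rewrite -subr_eq opprK dE; last by rewrite -mulrDr mulr_gt0.
  rewrite mdot_reg mdotDr -[(t * be)%:M]scalemx1 mdotZr mdot1r mxtraceD mxtraceZ mxtrace1.
  by rewrite /k1 /k2; apply/eqP; ring.
have h3 : `|t * (k1 + t * k2)| < e / 2.
  apply: le_lt_trans h2; rewrite [t * (_ + _)]mulrC normrM [leRHS]normrM.
  rewrite (gtr0_norm t0) ler_wpM2r ?(ltW t0) //.
  rewrite (ger0_norm (addr_ge0 (normr_ge0 k1) (normr_ge0 k2))).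
  rewrite (le_trans (ler_normD _ _)) // lerD2l normrM.
  by rewrite ler_piMl // gtr0_norm // ltW.
rewrite dE; move: h1 h3; 
move: (wlim B G c be al) (vreg B G c (t * be) (t * al)) (t * (k1 + t * k2)).
move=> w u v h1 h3; have := ltrD h1 h3.
rewrite -splitr; apply: le_lt_trans; rewrite -normrN.
have -> : - (mdot C B - w - (mdot C B + v - u)) = (w - u) + v by ring.
exact: ler_normD.
Qed.

Lemma va_duality (x : R) : 0 <= x <= pi / 2 ->
  va C A b x = mdot C B - va B G c (pi / 2 - x).
Proof.
move=> /andP[x0 x1]; rewrite !vaE -[pi / 2 - x]opprB cosN sinN cosBpihalf sinBpihalf opprK.
apply: wlim_duality.
- by apply: cos_ge0_pihalf; rewrite x1 andbT (le_trans _ x0) // oppr_le0 (le_trans x0).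
- by apply: sin_ge0_pi; rewrite x0 (le_trans x1) //; have := @pi_ge0 R; lra.
have c0 : 0 <= cos x.
  by apply: cos_ge0_pihalf; rewrite x1 andbT (le_trans _ x0) // oppr_le0 (le_trans x0).
have s0 : 0 <= sin x.
  by apply: sin_ge0_pi; rewrite x0 (le_trans x1) //; have := @pi_ge0 R; lra.
by have := cos2Dsin2 x; nra.
Qed.
End LimitDuality.

(** * Concave nondecreasing functions on the half-line *)

Section ConcaveMonotone.
Context {R : realType}.
Variable h : R -> R.
Hypothesis h_mono : forall r s, 0 <= r -> r <= s -> h r <= h s.
Hypothesis h_concave : forall a r s, 0 <= a <= 1 -> 0 <= r -> 0 <= s ->
  a * h r + (1 - a) * h s <= h (a * r + (1 - a) * s).

(** [q] is a convex combination of [p] and [r] with positive weight on [r], so a larger [h r] would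
    raise [h q] above [h p]. *)
Lemma concave_flat p q r : 0 <= p -> p < q -> q < r -> h q = h p -> h r <= h q.
Proof.
move=> p0 pq qr hqp; pose a := (r - q) / (r - p).
have rp : 0 < r - p by lra.
have a0 : 0 <= a by rewrite /a divr_ge0 //; lra.
have a1 : a < 1 by rewrite /a ltr_pdivrMr //; lra.
have qE : a * p + (1 - a) * r = q by rewrite /a; field; rewrite gt_eqF.
have r0 : 0 <= r by lra.
have := @h_concave a p r; rewrite a0 (ltW a1) => /(_ isT p0 r0).
by rewrite qE -hqp; nra.
Qed.

Lemma concave_lipschitz r0 r : 0 < r0 -> 0 <= r <= 2 * r0 ->
  `|h r0 - h r| <= (h (2 * r0) - h 0) / r0 * `|r0 - r|.
Proof.
move=> r00 /andP[rge0 r2].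
(* Concavity on the chord from [0] to [q], with weight [p / q], bounds the increment. *)
have hD p q : 0 <= p -> p <= q -> 0 < q -> q <= 2 * r0 ->
    h q - h p <= (1 - p / q) * (h (2 * r0) - h 0).
  move=> p0 pq q0 q2.
  have a0 : 0 <= p / q by rewrite divr_ge0 // ltW.
  have a1 : p / q <= 1 by rewrite ler_pdivrMr // mul1r.
  have := @h_concave (p / q) q 0; rewrite a0 a1 => /(_ isT (ltW q0) (lexx _)).
  rewrite mulr0 addr0 divfK ?gt_eqF // => hc.
  apply: (@le_trans _ _ ((1 - p / q) * (h q - h 0))); first by lra.
  by apply: ler_wpM2l; rewrite ?subr_ge0 // lerD2r; exact: h_mono (ltW q0) q2.
have D0 : 0 <= h (2 * r0) - h 0 by rewrite subr_ge0 h_mono // mulr_ge0 // ltW.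
have [rr0|/ltW rr0] := leP r r0.
  have mon := h_mono rge0 rr0.
  rewrite !ger0_norm ?subr_ge0 //.
  have := hD r r0 rge0 rr0 r00; have -> : r0 <= 2 * r0 by lra.
  move=> /(_ isT)/le_trans; apply; rewrite le_eqVlt; apply/orP; left; apply/eqP.
  by field; rewrite gt_eqF.
have mon := h_mono (ltW r00) rr0.
rewrite -normrN -[`|r0 - r|]normrN !opprB !ger0_norm ?subr_ge0 //.
have rgt0 := lt_le_trans r00 rr0.
apply: le_trans (hD r0 r (ltW r00) rr0 rgt0 r2) _.
rewrite mulrC -mulrA ler_wpM2l // -[1](divff (lt0r_neq0 rgt0)) -mulrBl mulrC.
by rewrite ler_wpM2r ?subr_ge0 // lef_pV2.
Qed.

End ConcaveMonotone.

(** * The limiting value as a function of the cotangent *)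

Section LimitFunction.
Context {R : realType} {n m : nat}.
Variables (C : 'M[R]_n) (A : 'I_m -> 'M[R]_n) (b : 'I_m -> R).
Hypotheses (fP : primal_feasible A b) (fD : dual_feasible C A).
Local Notation va := (va C A b).
(** Rays normalized to second coordinate [1], so that [va x] becomes [h (cot x)]. *)
Let h (r : R) : R := wlim C A b r 1.
Let cot (x : R) := cos x / sin x.

Let pi2_gt0 : 0 < pi / 2 :> R.
Proof. by rewrite divr_gt0 // pi_gt0. Qed.

Lemma sin_gt0_pihalf_le (x : R) : 0 < x <= pi / 2 -> 0 < sin x.
Proof.
by move=> /andP[x0 x1]; apply: sin_gt0_pi; rewrite x0 (le_lt_trans x1) //; lra.
Qed.

Lemma cos_ge0_0pihalf (x : R) : 0 <= x <= pi / 2 -> 0 <= cos x.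
Proof. by move=> /andP[x0 x1]; apply: cos_ge0_pihalf; rewrite x1 andbT; lra. Qed.

Let cot_ge0 x : 0 < x <= pi / 2 -> 0 <= cot x.
Proof.
move=> /[dup] /sin_gt0_pihalf_le s0 /andP[x0 x1].
by rewrite divr_ge0 ?(ltW s0) // cos_ge0_0pihalf // ltW.
Qed.

Let cot_lt x y : 0 < x -> x < y -> y <= pi / 2 -> cot y < cot x.
Proof.
move=> x0 xy y1; have y0 := lt_trans x0 xy; have x1 := ltW (lt_le_trans xy y1).
have sx : 0 < sin x by apply: sin_gt0_pihalf_le; rewrite x0.
have sy : 0 < sin y by apply: sin_gt0_pihalf_le; rewrite y0.
have cy : 0 <= cos y by apply: cos_ge0_0pihalf; rewrite (ltW y0).
have cxy : cos y < cos x by rewrite ltr_cos // in_itv /=; apply/andP; split; lra.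
have sxy : sin x < sin y by rewrite ltr_sin // in_itv /=; apply/andP; split; lra.
by rewrite /cot ltr_pdivrMr // mulrAC ltr_pdivlMr //; nra.
Qed.

Lemma va_cot x : 0 < x <= pi / 2 -> va x = h (cot x).
Proof.
move=> x01; have s0 := sin_gt0_pihalf_le x01; rewrite vaE.
have := wlim_scale fP fD s0 (cot_ge0 x01) ler01.
by rewrite mulr1 mulrCA divff ?mulr1 ?gt_eqF.
Qed.

Lemma va_pihalf : va (pi / 2) = h 0.
Proof. by rewrite vaE cos_pihalf sin_pihalf. Qed.

Let h_mono r s : 0 <= r -> r <= s -> h r <= h s.
Proof. by move=> r0 rs; apply: wlim_mono. Qed.

Let h_concave a r s : 0 <= a <= 1 -> 0 <= r -> 0 <= s ->
  a * h r + (1 - a) * h s <= h (a * r + (1 - a) * s).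
Proof. by move=> a01 r0 s0; apply: wlim_concave. Qed.

Lemma va_le x y : 0 < x -> x <= y -> y <= pi / 2 -> va y <= va x.
Proof.
move=> x0; rewrite le_eqVlt => /predU1P[-> //|xy y1].
have y01 : 0 < y <= pi / 2 by rewrite y1 andbT (lt_trans x0).
have x01 : 0 < x <= pi / 2 by rewrite x0 (ltW (lt_le_trans xy y1)).
rewrite (va_cot y01) (va_cot x01); apply: h_mono; first exact: cot_ge0.
exact/ltW/cot_lt.
Qed.

(** The cotangent reverses order, so [concave_flat] acts to the left of a flat piece. *)
Lemma va_flat x y z : 0 < z -> z < x -> x < y -> y <= pi / 2 -> va x = va y ->
  va z <= va x.
Proof.
move=> z0 zx xy y1; have x0 := lt_trans z0 zx; have y0 := lt_trans x0 xy.
have x1 := le_trans (ltW xy) y1; have z1 := le_trans (ltW zx) x1.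
have cy : 0 <= cot y by apply: cot_ge0; rewrite y0.
have xy' := cot_lt x0 xy y1; have zx' := cot_lt z0 zx x1.
have x01 : 0 < x <= pi / 2 by rewrite x0.
have y01 : 0 < y <= pi / 2 by rewrite y0.
have z01 : 0 < z <= pi / 2 by rewrite z0.
rewrite (va_cot x01) (va_cot y01) (va_cot z01) => hxy.
exact: (concave_flat h_concave cy xy' zx' hxy).
Qed.

Let cot_cvg (x : R) : 0 < x <= pi / 2 -> cot y @[y --> x] --> cot x.
Proof.
move=> x01; apply: cvgM; first exact: continuous_cos.
by apply: cvgV; [rewrite gt_eqF // sin_gt0_pihalf_le|exact: continuous_sin].
Qed.

Lemma va_continuous_interior (x : R) : 0 < x < pi / 2 -> {for x, continuous va}.
Proof.
move=> /andP[x0 x1]; have x01 : 0 < x <= pi / 2 by rewrite x0 ltW.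
have r0 : 0 < cot x.
  rewrite divr_gt0 ?sin_gt0_pihalf_le //; apply: cos_gt0_pihalf.
  by rewrite x1 andbT; lra.
pose K := (h (2 * cot x) - h 0) / cot x.
have K0 : 0 <= K.
  by rewrite divr_ge0 ?(ltW r0) // subr_ge0 h_mono // mulr_ge0 // ltW.
apply/cvgrPdist_lt => e e0.
have e1 : 0 < e / (K + 1) by rewrite divr_gt0 // ltr_wpDl.
have /cvgrPdist_lt cvg_cot := cot_cvg x01.
near=> y.
have y01 : 0 < y <= pi / 2.
  by apply/andP; split; last apply: ltW; near: y; [exact: lt_nbhsr|exact: lt_nbhsl].
rewrite (va_cot x01) (va_cot y01).
have d1 : `|cot x - cot y| < e / (K + 1) by near: y; exact: cvg_cot.
(* Keeps [cot y] below [2 * cot x], where the Lipschitz bound applies. *)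
have d2 : `|cot x - cot y| < cot x by near: y; exact: cvg_cot.
apply: le_lt_trans (@concave_lipschitz R h h_mono h_concave _ _ r0 _) _.
  rewrite cot_ge0 //=; move: d2; rewrite ltr_norml => /andP[]; lra.
rewrite -/K; move: d1; rewrite ltr_pdivlMr ?ltr_wpDl // => d1.
by apply: le_lt_trans d1; rewrite mulrC ler_wpM2l // lerDl.
Unshelve. all: by end_near. Qed.

Lemma va_pihalf_bound : symm_mx C -> (forall i, symm_mx (A i)) -> D_sing_deg_one C A ->
  exists2 K : R, 0 <= K & forall x, 0 < x < pi / 2 ->
    va (pi / 2) <= va x <= va (pi / 2) + K * (cos x / sin x).
Proof.
move=> sC sA sing; have [K K0 HK] := wlim_sing_bound fP fD sC sA sing.
exists K => // x /andP[x0 x1]; have x01 : 0 < x <= pi / 2 by rewrite x0 ltW.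
rewrite va_pihalf (va_cot x01); apply/andP; split; first exact/h_mono/cot_ge0.
by have := HK (cot x) 1 (cot_ge0 x01) ltr01; rewrite divr1.
Qed.

(** Squeeze by [va_pihalf_bound], since the cotangent vanishes at [pi / 2]. *)
Lemma va_cvg_pihalf : symm_mx C -> (forall i, symm_mx (A i)) -> D_sing_deg_one C A ->
  va x @[x --> (pi / 2)^'-] --> (va (pi / 2) : R^o).
Proof.
move=> sC sA sing; have [K K0 HK] := va_pihalf_bound sC sA sing.
apply: (@squeeze_cvgr _ _ _ _ (fun=> va (pi / 2)) (fun x => va (pi / 2) + K * cot x)).
- near=> x; apply: HK; apply/andP; split; near: x.
    exact: nbhs_left_gt.
  exact: nbhs_left_lt.
- exact: cvg_cst.
rewrite -[X in _ --> X]addr0; apply: cvgD; first exact: cvg_cst.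
rewrite -(mulr0 K); apply: cvgMr; apply: cvg_at_left_filter.
rewrite -[X in _ --> X](_ : cot (pi / 2) = 0); last by rewrite /cot cos_pihalf mul0r.
by apply: cot_cvg; rewrite pi2_gt0 lexx.
Unshelve. all: by end_near. Qed.

(** Were [va 0] larger than [va x], convergence would give some [z < x] with [va z > va x], against
    [va_flat]. *)
Lemma va_flat0 (x y : R) : va z @[z --> 0^'+] --> (va 0 : R^o) ->
  0 <= x -> x < y -> y <= pi / 2 -> va x = va y -> va 0 <= va x.
Proof.
move=> cvg0; rewrite le_eqVlt => /predU1P[<- //|x0] xy y1 vxy.
rewrite leNgt; apply/negP => lt0.
have [z z0 [zx vz]] : exists2 z, 0 < z & z < x /\ va x < va z.
  apply: right0_ex; apply: right0I; first exact: right0_lt.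
  by apply: near_right0; exact: cvgr_gt cvg0 _ lt0.
by have := va_flat z0 zx xy y1 vxy; rewrite leNgt vz.
Qed.
End LimitFunction.

(** * Both endpoints, through the exchanged pair *)

Section LimitPair.
Context {R : realType} {n m k : nat}.
Variables (C B : 'M[R]_n) (A : 'I_m -> 'M[R]_n) (G : 'I_k -> 'M[R]_n).
Hypotheses (sC : symm_mx C) (sB : symm_mx B) (AG : dual_pair A G).
Local Notation b := (fun i => mdot (A i) B).
Local Notation c := (fun j => mdot (G j) C).
Hypotheses (fP : primal_feasible A b) (fD : dual_feasible C A).

Let fP' : primal_feasible G c. Proof. exact: (pair_primal_feasible AG fD). Qed.
Let fD' : dual_feasible B G. Proof. exact: (pair_dual_feasible sB AG fP). Qed.
Let pi2_gt0 : 0 < pi / 2 :> R.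
Proof. by rewrite divr_gt0 // pi_gt0. Qed.

Lemma va0 : va C A b 0 = vP C A b.
Proof. by rewrite vaE cos0 sin0 wlim10. Qed.

Lemma va_pihalf_vD : va C A b (pi / 2) = vD C A b.
Proof.
rewrite (va_duality sC sB AG fP fD); last by rewrite lexx ltW.
rewrite subrr (vD_pair sC AG fP fD fD').
by rewrite vaE cos0 sin0 wlim10.
Qed.

Lemma va_nonincreasing (x y : R) : 0 <= x -> x <= y -> y <= pi / 2 ->
  va C A b y <= va C A b x.
Proof.
rewrite le_eqVlt => /predU1P[<-|x0]; last exact: va_le.
rewrite le_eqVlt => /predU1P[<- //|y0] y1.
(* The cotangent does not describe [0]. From [y] to [y / 2] monotonicity is [va_le]; from [y / 2] to
   [0] it is [va_le] for the exchanged pair, where [0] becomes [pi / 2]. *)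
have z0 : 0 < y / 2 by lra.
have zy : y / 2 <= y by lra.
apply: le_trans (va_le fP fD z0 zy y1) _.
have z1 := le_trans zy y1.
have z01 : 0 <= y / 2 <= pi / 2 by rewrite z1 ltW.
have o01 : 0 <= (0 : R) <= pi / 2 by rewrite lexx ltW.
have h1 : 0 < pi / 2 - y / 2 by lra.
rewrite (va_duality sC sB AG fP fD z01) (va_duality sC sB AG fP fD o01).
rewrite subr0 lerD2l lerN2; apply: (va_le fP' fD' h1); last exact: lexx.
by rewrite gerBl ltW.
Qed.

(** The bound of the exchanged pair at [pi / 2 - x] becomes a lower bound with error
    [K * (sin x / cos x)]. *)
Lemma va_cvg_0 : D_sing_deg_one B G -> va C A b x @[x --> 0^'+] --> (va C A b 0 : R^o).
Proof.
have [_ sG _ _ _] := AG.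
move=> sing; have [K K0 HK] := va_pihalf_bound fP' fD' sB sG sing.
have vaE0 : va C A b 0 = mdot C B - va B G c (pi / 2).
  by rewrite (va_duality sC sB AG fP fD) ?subr0 // lexx ltW.
have tan0 : sin x / cos x @[x --> (0 : R)^'+] --> (0 : R).
  apply: cvg_at_right_filter.
  rewrite -[X in _ --> X](_ : sin 0 / cos 0 = 0 :> R); last by rewrite sin0 mul0r.
  apply: cvgM; first exact: continuous_sin.
  by apply: cvgV; [rewrite cos0 oner_neq0|exact: continuous_cos].
apply: (@squeeze_cvgr _ _ _ _ (fun x => va C A b 0 - K * (sin x / cos x))
  (fun=> va C A b 0)).
- near=> x.
  have x0 : 0 < x by near: x; exact: nbhs_right_gt.
  have x1 : x < pi / 2 by near: x; exact: nbhs_right_lt.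
  have x01 : 0 <= x <= pi / 2 by rewrite !ltW.
  rewrite va_nonincreasing ?(ltW x0) ?(ltW x1) // andbT.
  have := HK (pi / 2 - x); rewrite subr_gt0 x1 ltrBlDr ltrDl x0 => /(_ isT)/andP[_].
  rewrite vaE0 (va_duality sC sB AG fP fD x01) -[pi / 2 - x]opprB.
  rewrite cosN sinN cosBpihalf sinBpihalf opprK.
  by move=> h; rewrite -addrA -opprD lerD2l lerN2; exact: h.
- rewrite -[X in _ --> X]subr0; apply: cvgB; first exact: cvg_cst.
  by rewrite -[X in _ --> X](mulr0 K); apply: cvgMr; exact: tan0.
- exact: cvg_cst.
Unshelve. all: by end_near. Qed.
End LimitPair.

(** * Continuous decreasing bijections, and the conclusion *)

Lemma decreasing_bij (R : realType) (f : R -> R) (a b : R) : a <= b ->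
  (forall x y, a <= x -> x <= y -> y <= b -> f y <= f x) ->
  (forall x y, a <= x -> x < y -> y <= b -> f x <> f y) ->
  {within `[a, b]%classic, continuous f} ->
  set_bij `[a, b]%classic `[f b, f a]%classic f.
Proof.
move=> ab noninc inj cont; split.
- move=> x; rewrite /= !in_itv /= => /andP[ax xb].
  by rewrite !noninc.
- move=> x y; rewrite !inE /= !in_itv /= => /andP[ax xb] /andP[ay yb] fxy.
  by case: (ltgtP x y) => // xy; [case: (inj _ _ ax xy yb)|case: (inj _ _ ay xy xb)].
- move=> v; rewrite /= in_itv /= => vI; have fab := noninc a b (lexx a) ab (lexx b).
  have [|x xI <-] := @IVT R f a b v ab cont; last by exists x.
  by rewrite (min_idPr fab) (max_idPl fab).
Qed.

Theorem theorem2 (R : realType) (n m : nat) (C : 'M[R]_n)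
  (A : 'I_m -> 'M[R]_n) (b : 'I_m -> R) :
  symm_mx C -> (forall i, symm_mx (A i)) ->
  primal_feasible A b -> dual_feasible C A ->
  let va := va C A b in
  (D_sing_deg_one C A ->
     va x @[x --> ((pi : R) / 2)^'-] --> (va (pi / 2) : R^o)) /\
  (P_sing_deg_one A b ->
     va x @[x --> (0 : R)^'+] --> (va 0 : R^o)) /\
  (D_sing_deg_one C A -> P_sing_deg_one A b ->
     (va x @[x --> ((pi : R) / 2)^'-] --> (va (pi / 2) : R^o)) /\
     (va x @[x --> (0 : R)^'+] --> (va 0 : R^o)) /\
     (vP C A b <> vD C A b ->
        {in `[0, pi / 2] &, {homo va : x y /~ x <= y}} /\
        {within `[0, pi / 2]%classic, continuous va} /\
        set_bij `[0, pi / 2]%classic `[vD C A b, vP C A b]%classic va)).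
Proof.
move=> sC sA fP fD.
(* A feasible point serves as [B], and [b] is expressed through it. *)
have [B [[sB _] /funext bE]] := fP; rewrite -bE in fP *; clear bE b.
have [G AG] := dual_pair_exists sA; have GA := dual_pair_sym AG.
set b := (fun i => mdot (A i) B) in fP *; cbv zeta.
pose c j := mdot (G j) C.
have fP' : primal_feasible G c := pair_primal_feasible AG fD.
have fD' : dual_feasible B G := pair_dual_feasible sB AG fP.
have cvg1 : D_sing_deg_one C A ->
    va C A b x @[x --> ((pi : R) / 2)^'-] --> (va C A b (pi / 2) : R^o).
  exact: va_cvg_pihalf.
have cvg0 : P_sing_deg_one A b -> va C A b x @[x --> (0 : R)^'+] --> (va C A b 0 : R^o).
  by move=> /(P_sing_dual sB AG fP); exact: (va_cvg_0 sC sB AG fP fD).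
split; first exact: cvg1.
split; first exact: cvg0.
move=> singD singP; split; first exact: cvg1.
split; first exact: cvg0.
move=> gap.
have v0 : va C A b 0 = vP C A b := va0 fP fD.
have v1 : va C A b (pi / 2) = vD C A b := va_pihalf_vD sC sB AG fP fD.
have noninc := va_nonincreasing sC sB AG fP fD.
have pi2 : 0 < pi / 2 :> R by rewrite divr_gt0 // pi_gt0.
have cont : {within `[0, pi / 2]%classic, continuous (va C A b)}.
  apply/continuous_within_itvP; first exact: pi2.
  split; [|exact: cvg0 singP|exact: cvg1 singD].
  by move=> x; rewrite in_itv => /= /(va_continuous_interior fP fD).
split.
  move=> x y; rewrite !in_itv /= => /andP[x0 x1] /andP[y0 y1] yx.
  exact: noninc.
split; first exact: cont.
rewrite -v0 -v1; apply: decreasing_bij; [exact: ltW|exact: noninc| |exact: cont].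
move=> x y x0 xy y1 vxy; apply: gap; rewrite -v0 -v1; apply: le_anti.
apply/andP; split; last exact: noninc (lexx 0) (ltW pi2) (lexx _).
(* If [va x = va y] with [x < y], then [va 0 <= va x]; the same fact for the exchanged pair gives
   [va y <= va (pi / 2)], so the gap closes. *)
apply: (le_trans (va_flat0 fP fD (cvg0 singP) x0 xy y1 vxy)); rewrite vxy.
have dE (u : R) : 0 <= u <= pi / 2 -> va C A b u = mdot C B - va B G c (pi / 2 - u).
  exact: (va_duality sC sB AG fP fD).
have y0 := le_lt_trans x0 xy; have x1 := ltW (lt_le_trans xy y1).
have x01 : 0 <= x <= pi / 2 by rewrite x0.
have y01 : 0 <= y <= pi / 2 by rewrite (ltW y0).
have p01 : 0 <= (pi : R) / 2 <= pi / 2.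
  by apply/andP; split; [exact: ltW|exact: lexx].
have cvg0' : va B G c z @[z --> 0^'+] --> (va B G c 0 : R^o).
  exact: (va_cvg_0 sB sC GA fP' fD' singD).
have yx' : pi / 2 - y < pi / 2 - x by rewrite ltrD2l ltrN2.
have y0' : 0 <= pi / 2 - y by rewrite subr_ge0.
have x1' : pi / 2 - x <= pi / 2 by rewrite gerBl.
have vxy' : va B G c (pi / 2 - y) = va B G c (pi / 2 - x).
  by move: vxy; rewrite (dE x x01) (dE y y01) => /addrI/oppr_inj/esym; exact: id.
rewrite (dE y y01) (dE _ p01) subrr lerD2l lerN2.
exact: (va_flat0 fP' fD' cvg0' y0' yx' x1' vxy').
Qed.
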